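(* For compositions $\alpha,\beta$ let $f_{\alpha,\beta}$ denote the number of maximal chains from $\alpha$ to $\beta$ in $\mathcal{R}_c$. Then $$f_{\alpha,\beta}=\sum_{\gamma\vDash|\beta|-|\alpha|}C^{\beta}_{\alpha\gamma}\,f_{\varnothing,\gamma}.$$
   Context: Compositions have positive parts; $\varnothing$ is the empty composition and $\gamma\vDash k$ means $\gamma$ is a composition of $k$. Operators: $\mathfrak{d}_i(\alpha)$ subtracts $1$ from the rightmost part of $\alpha$ equal to $i$ (deleting a resulting $0$), or is $0$ if there is no such part; operators send $0$ to $0$; $\mathfrak{v}_{[i-1]}=\mathfrak{d}_1\cdots\mathfrak{d}_{i-1}$ ($\mathfrak{d}_{i-1}$ applied first; $\mathfrak{v}_{[0]}=\mathrm{id}$); $a_i$ appends a part $i$; $u_i=a_i\mathfrak{v}_{[i-1]}$. $\mathcal{R}_c$ is the poset on compositions with cover relation $\alpha\lessdot_r\beta$ iff $\beta=u_i(\alpha)$ for some $i\geq1$; a maximal chain from $\alpha$ to $\beta$ is a sequence $\alpha=\alpha^{(0)}\lessdot_r\cdots\lessdot_r\alpha^{(k)}=\beta$. $\mathbf{NSym}=\mathbb{Q}\langle\mathbf{h}_1,\mathbf{h}_2,\ldots\rangle$, $\mathbf{h}_\alpha=\mathbf{h}_{\alpha_1}\cdots\mathbf{h}_{\alpha_k}$, ribbons $\mathbf{r}_\beta=\sum_{\alpha\succcurlyeq\beta}(-1)^{l(\beta)-l(\alpha)}\mathbf{h}_\alpha$ ($\alpha\succcurlyeq\beta$: parts of $\alpha$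 are sums of adjacent parts of $\beta$). An SRCT of shape $\alpha\vDash m$ is a bijective filling of the reverse composition diagram (row $r$ from the top has $\alpha_r$ left-justified boxes) by $[m]$ with rows decreasing left to right, first column increasing top to bottom, and: for rows $r<s$ and column $c$ with $(s,c+1)$ a box, if $\tau(r,c)>\tau(s,c+1)$ then $(r,c+1)$ is a box with $\tau(r,c+1)>\tau(s,c+1)$. Its descent set is $\{j: j+1 \text{ lies weakly right of } j\}$ and its descent composition is the associated composition of $m$. The noncommutative Schur functions $\mathbf{s}_\alpha$ are defined by $\mathbf{r}_\beta=\sum_\alpha d_{\alpha\beta}\mathbf{s}_\alpha$, $d_{\alpha\beta}$ the number of SRCTs of shape $\alpha$ and descent composition $\beta$; they form a basis. The coefficients $C^\beta_{\alpha\gamma}$ are defined by $\mathbf{s}_\alpha\cdot\mathbf{s}_\gamma=\sum_\beta C^\beta_{\alpha\gamma}\mathbf{s}_\beta$. *)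

(* Defs.v *)
From mathcomp Require Import all_boot all_order all_algebra.
Set Implicit Arguments. Unset Strict Implicit. Unset Printing Implicit Defensive.
Import Order.TTheory GRing.Theory Num.Theory.

Definition is_comp (a : seq nat) : bool := all (fun x => 0 < x) a.

Fixpoint compsF (fuel m : nat) : seq (seq nat) :=
  match fuel with
  | 0 => if m == 0 then [:: [::]] else [::]
  | f.+1 =>
      if m == 0 then [:: [::]]
      else flatten [seq [seq i :: c | c <- compsF f (m - i)] | i <- iota 1 m]
  end.

Definition comps (m : nat) : seq (seq nat) := compsF m m.

(* Operators d_i, v_[i-1], a_i, u_i  (None plays the role of 0)        *)

Definition dop (i : nat) (a : seq nat) : option (seq nat) :=
  let s := rev a in
  if i \in s then
    let k := index i s in
    Some (rev (if i == 1 then take k s ++ drop k.+1 s else set_nth 0 s k i.-1))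
  else None.

(* v_[i-1] = d_1 ... d_{i-1}, with d_{i-1} applied first; v_[0] = id. *)
Definition vop (i : nat) (a : seq nat) : option (seq nat) :=
  foldr (fun j acc => obind (dop j) acc) (Some a) (iota 1 i.-1).

Definition uop (i : nat) (a : seq nat) : option (seq nat) :=
  omap (fun b => rcons b i) (vop i a).

(* Cover relation of R_c: b = u_i(a) for some i >= 1.  Since i is then a part
   of b, necessarily i <= |b|, so the search range is no restriction. *)
Definition covb (a b : seq nat) : bool :=
  has (fun i => uop i a == Some b) (iota 1 (sumn b)).

(* Number of chains a = a0 <. a1 <. ... <. ak = b of length k, where each
   intermediate element is searched among the compositions of |b| minus the
   remaining number of steps (every cover raises the size by exactly 1). *)
Fixpoint nchains (k : nat) (a b : seq nat) : nat :=
  match k with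
  | 0 => (a == b : nat)
  | k'.+1 => \sum_(d <- comps (sumn b).-1) nchains k' a d * covb d b
  end.

Definition fchains (a b : seq nat) : nat := nchains (sumn b - sumn a) a b.

(* entry of a tableau (list of rows, top to bottom), 0 if no box *)
Definition ent (T : seq (seq nat)) (r c : nat) : nat := nth 0 (nth [::] T r) c.

Definition is_SRCT (m : nat) (T : seq (seq nat)) : bool :=
  [&& all (fun row => sorted (fun x y => y < x) row) T,
      sorted ltn (map (head 0) T)
    & all (fun s => all (fun r => all (fun c =>
          (c.+1 < size (nth [::] T s)) ==>
          (ent T s c.+1 < ent T r c) ==>
          (ent T s c.+1 < ent T r c.+1))
        (iota 0 m)) (iota 0 s)) (iota 0 (size T))].

Definition colof (T : seq (seq nat)) (v : nat) : nat :=
  index v (nth [::] T (find (fun row => v \in row) T)).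

Definition descents (m : nat) (T : seq (seq nat)) : seq nat :=
  [seq j <- iota 1 m.-1 | colof T j <= colof T j.+1].

Definition set_to_comp (m : nat) (S : seq nat) : seq nat :=
  if m == 0 then [::] else pairmap (fun x y => y - x) 0 (rcons S m).

Definition descomp (m : nat) (T : seq (seq nat)) : seq nat :=
  set_to_comp m (descents m T).

(* d_{alpha beta}: number of SRCTs of shape alpha with descent composition beta.
   Bijective fillings by [m] = permutations of [1..m] read row by row. *)
Definition dcoef (a b : seq nat) : nat :=
  let m := sumn a in
  count (fun p => let T := reshape a p in is_SRCT m T && (descomp m T == b))
        (permutations (iota 1 m)).

(* NSym in coordinates: degree-m component with basis h_tau, tau |= m   *)
Local Open Scope ring_scope.

Definition nc (m : nat) : nat := size (comps m).
Definition cmp (m : nat) (i : 'I_(nc m)) : seq nat := nth [::] (comps m) i.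

Definition coarsens (a b : seq nat) : bool :=
  has (fun l => map sumn (reshape l b) == a) (comps (size b)).

(* coefficient of h_t in the ribbon r_b *)
Definition rcoef (t b : seq nat) : rat :=
  if coarsens t b then (-1) ^+ (size b - size t) else 0.

Definition Hmx (m : nat) : 'M[rat]_(nc m) := \matrix_(i, j) rcoef (cmp i) (cmp j).
(* D_m(a,b) = d_{a b}, so that r_b = sum_a D(a,b) s_a *)
Definition Dmx (m : nat) : 'M[rat]_(nc m) := \matrix_(i, j) (dcoef (cmp i) (cmp j))%:R.
(* S_m(t,a) = coefficient of h_t in s_a :  s_a = sum_b (D^-1)(b,a) r_b *)
Definition Smx (m : nat) : 'M[rat]_(nc m) := Hmx m *m invmx (Dmx m).

Definition scoef (m : nat) (t a : seq nat) : rat :=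
  \sum_(i < nc m) \sum_(j < nc m)
     (if (cmp i == t) && (cmp j == a) then Smx m i j else 0).

(* coefficient of h_t in the product s_a * s_g  (h_x h_y = h_{x ++ y}) *)
Definition prodcoef (a g t : seq nat) : rat :=
  \sum_(t1 <- comps (sumn a)) \sum_(t2 <- comps (sumn g))
     (if t1 ++ t2 == t then scoef (sumn a) t1 a * scoef (sumn g) t2 g else 0).

(* C^b_{a g} : coefficient of s_b in s_a * s_g *)
Definition Ccoef (a g b : seq nat) : rat :=
  let N := (sumn a + sumn g)%N in
  if sumn b == N then
    \sum_(i < nc N) \sum_(j < nc N)
       (if cmp i == b then invmx (Smx N) i j * prodcoef a g (cmp j) else 0)
  else 0.

(* Main.v *)
(* Right multiplication of s_alpha by h_1 = s_(1) is the sum of all s_beta covering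
   alpha in R_c (right Pieri rule), so f_(alpha,beta) is the coefficient of s_beta in
   s_alpha h_1^k.  Expanding h_1^k = sum_gamma f_(empty,gamma) s_gamma gives the theorem.

   For the Pieri rule, a tableau is encoded by the word w listing the columns of its
   entries 1, 2, ..., m: its shape is obtained by applying to the empty composition the
   operators that add a box in column c to the leftmost possible part, and its descents
   are the weak ascents of w.  These left operators commute with the right operators u_i
   up to a local exchange of indices which does not change the descents; this yields a
   bijection equivalent to d_(gamma, b.1) + d_(gamma, b(.)1) = sum of d_(alpha, b) over the
   alpha covered by gamma, which is dual to r_b h_1 = r_(b.1) + r_(b(.)1). *)
Require Import Defs.
From mathcomp Require Import all_boot all_order all_algebra zify.
Import GRing.Theory Num.Theory.
Set Implicit Arguments. Unset Strict Implicit. Unset Printing Implicit Defensive.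

(** * Enumeration of compositions, counting by bijections, triangular matrices *)

Lemma mem_compsF f m c : m <= f -> (c \in compsF f m) = is_comp c && (sumn c == m).
Proof.
have nil x : (x \in [:: [::]]) = is_comp x && (sumn x == 0).
  by rewrite inE; case: x => [|[|x] d] //=; rewrite addSn andbF.
elim: f m c => [|f IH] [|m] c le_mf //.
apply/flatten_mapP/andP => [[i]|[pc /eqP sc]].
  rewrite mem_iota => /andP[i0 im] /mapP[c' + ->].
  rewrite IH; last by lia.
  by move=> /andP[pc /eqP sc] /=; rewrite i0; split => //; apply/eqP; lia.
case: c pc sc => // x c /= /andP[x0 pc] sc.
exists x; first by rewrite -[_ :: iota _ _]/(iota 1 m.+1) mem_iota; lia.
apply: map_f; rewrite IH; last by lia.
by rewrite pc; apply/eqP; lia.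
Qed.

Lemma mem_comps m c : (c \in comps m) = is_comp c && (sumn c == m).
Proof. exact: mem_compsF. Qed.

Lemma uniq_compsF f m : uniq (compsF f m).
Proof.
elim: f m => [|f IH] [|m] //=.
rewrite -[[seq _ :: _ | _ <- _] ++ _]/(flatten [seq [seq i :: c | c <- compsF f (m.+1 - i)] | i <- iota 1 m.+1]).
apply: allpairs_uniq_dep; first exact: iota_uniq.
  by move=> i _; apply: IH.
by move=> [i c] [j d] _ _ /= [-> ->].
Qed.

Lemma uniq_comps m : uniq (comps m). Proof. exact: uniq_compsF. Qed.

Lemma cmpP m (i : 'I_(nc m)) : cmp i \in comps m.
Proof. exact: mem_nth. Qed.

Lemma cmp_inj m : injective (@cmp m).
Proof.
move=> i j /eqP; rewrite nth_uniq ?uniq_comps // => /eqP; exact: val_inj.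
Qed.

Lemma cmp_onto m c : c \in comps m -> exists i : 'I_(nc m), cmp i = c.
Proof.
move=> cm; have lt : index c (comps m) < nc m by rewrite index_mem.
by exists (Ordinal lt); rewrite /cmp nth_index.
Qed.

Lemma sum_cmp (R : nmodType) m (F : seq nat -> R) :
  (\sum_(i < nc m) F (cmp i) = \sum_(c <- comps m) F c)%R.
Proof. by rewrite (big_nth [::]) big_mkord. Qed.

Lemma sum_pick (R : nmodType) m c (F : seq nat -> R) : c \in comps m ->
  (\sum_(d <- comps m) (if d == c then F d else 0) = F c)%R.
Proof.
move=> cm; rewrite (bigD1_seq c) ?uniq_comps //= eqxx big1 ?addr0 //.
by move=> d /negPf ->.
Qed.

Lemma count_bij (T1 T2 : eqType) (s1 : seq T1) (s2 : seq T2) (P : pred T1)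
    (Q : pred T2) (f : T1 -> T2) (g : T2 -> T1) : uniq s1 -> uniq s2 ->
  (forall x, x \in s1 -> P x -> [/\ f x \in s2, Q (f x) & g (f x) = x]) ->
  (forall y, y \in s2 -> Q y -> [/\ g y \in s1, P (g y) & f (g y) = y]) ->
  count P s1 = count Q s2.
Proof.
move=> u1 u2 fP gP; rewrite -!size_filter -(size_map f); apply: perm_size.
apply: uniq_perm; rewrite ?filter_uniq // ?map_inj_in_uniq ?filter_uniq //.
  move=> x y; rewrite !mem_filter => /andP[px xs] /andP[py ys] e.
  by have [_ _ <-] := fP x xs px; have [_ _ <-] := fP y ys py; rewrite e.
move=> y; rewrite mem_filter; apply/mapP/andP => [[x]|[qy ys]].
  by rewrite mem_filter => /andP[px xs] ->; have [] := fP x xs px.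
by have [gs pg e] := gP y ys qy; exists (g y); rewrite ?mem_filter ?pg.
Qed.

(** A row vector killed by [A^T] vanishes by strong induction on [f i]: in the equation of index
    [i], every nonzero off-diagonal entry multiplies a coordinate of smaller [f], already zero. *)
Lemma triangular_unitmx n (f : 'I_n -> nat) (A : 'M[rat]_n) :
  (forall i, A i i != 0)%R ->
  (forall i j, i != j -> (A i j != 0)%R -> f j < f i) ->
  A \in unitmx.
Proof.
move=> A0 Af; rewrite -unitmx_tr -row_free_unit -kermx_eq0.
apply/eqP/row_matrixP => k; rewrite row0.
have : (row k (kermx A^T) *m A^T = 0)%R.
  by apply: sub_kermxP; apply: row_sub.
move: (row k _) => v vA; apply/rowP => i; rewrite [RHS]mxE.
have [N] := ubnP (f i); elim: N i => // N IH i fi.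
have /rowP/(_ i) := vA; rewrite !mxE (bigD1 i) //= !mxE big1 => [|j ji].
  by rewrite addr0 => /eqP; rewrite mulf_eq0 (negPf (A0 i)) orbF => /eqP.
rewrite mxE; have [->|nz] := eqVneq (A i j) 0%R; first by rewrite mulr0.
rewrite IH ?mul0r //.
have := Af i j; rewrite eq_sym ji nz => /(_ isT isT); lia.
Qed.

(** * Left and right operators on compositions *)

Fixpoint incr (c : nat) (a : seq nat) : option (seq nat) :=
  if a is x :: a' then
    if x == c then Some (c.+1 :: a') else omap (cons x) (incr c a')
  else None.

(* Columns are counted from 0, as in [colof]; the column [c] of [lop] is one less than
   the size of the part it creates. *)
Definition lop (c : nat) (a : seq nat) : option (seq nat) :=
  if c == 0 then Some (1 :: a) else incr c a.

(** Structural form of [dop]: the tail is tried first, so that the rightmost part [i] is the one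
    reduced. *)
Fixpoint decr (i : nat) (a : seq nat) : option (seq nat) :=
  if a is x :: a' then
    if decr i a' is Some b then Some (x :: b)
    else if x == i then Some (if i == 1 then a' else i.-1 :: a') else None
  else None.

Lemma decr_mem i a : isSome (decr i a) = (i \in a).
Proof.
elim: a => //= x a; rewrite inE; case: (decr i a) => [b|] <- /=.
  by rewrite orbT.
by rewrite eq_sym orbF; case: eqP.
Qed.

Lemma decr_None i a : i \notin a -> decr i a = None.
Proof. by rewrite -decr_mem; case: decr. Qed.

Lemma dopE i a : dop i a = decr i a.
Proof.
elim: a => [|x a IH] //=; rewrite -{}IH /dop rev_cons mem_rcons inE mem_rev.
case: (boolP (i \in a)) => [ia|nia]; last first.
  rewrite orbF eq_sym; case: eqP => [-> {x}|] //.
  rewrite -cats1 index_cat mem_rev (negPf nia) /= eqxx addn0 set_nthE.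
  rewrite size_cat /= addn1 leqnn take_size_cat // drop_oversize ?size_cat /= ?addn1 // cats0.
  by case: ifP => _; rewrite ?cats0 ?cats1 ?rev_rcons revK.
rewrite orbT -cats1 index_cat mem_rev ia.
have lt : index i (rev a) < size (rev a) by rewrite index_mem mem_rev.
rewrite !set_nthE lt size_cat ltn_addr // takel_cat ?(ltnW lt) // drop_cat.
have -> : (if (index i (rev a)).+1 < size (rev a) then
    drop (index i (rev a)).+1 (rev a) ++ [:: x]
   else drop ((index i (rev a)).+1 - size (rev a)) [:: x]) =
   drop (index i (rev a)).+1 (rev a) ++ [:: x].
  case: ltnP => // le; have -> : (index i (rev a)).+1 = size (rev a) by lia.
  by rewrite subnn drop0 drop_size.
by case: ifP => _; rewrite -?cat_cons catA cats1 rev_rcons.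
Qed.

Lemma vop1 a : vop 1 a = Some a. Proof. by []. Qed.

(** Peels off d_i, the factor that acts first. *)
Lemma vopS i a : 0 < i -> vop i.+1 a = obind (vop i) (decr i a).
Proof.
move=> i0; rewrite /vop /= -[in LHS](prednK i0) -(addn1 i.-1) iotaD foldr_cat /=.
rewrite add1n prednK // dopE; case: (decr i a) => //=.
by elim: (iota _ _) => //= j s ->.
Qed.

Lemma incr_None c a : c \notin a -> incr c a = None.
Proof.
by elim: a => //= x a IH; rewrite inE eq_sym => /norP[/negPf -> /IH ->].
Qed.

Lemma incr_Some c a : c \in a -> exists b, incr c a = Some b.
Proof.
elim: a => //= x a IH; rewrite inE eq_sym; case: eqP => [_ _|_ /= /IH[b ->]] /=; by eexists.
Qed.

Lemma incr_mem c a b : incr c a = Some b -> c.+1 \in b.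
Proof.
elim: a b => //= x a IH b; case: eqP => [_ [<-]|_]; first by rewrite inE eqxx.
by case: (incr c a) IH => //= d IH [<-]; rewrite inE (IH d) ?orbT.
Qed.

Lemma mem_incr c a b d : d != c -> d != c.+1 -> incr c a = Some b ->
  (d \in b) = (d \in a).
Proof.
move=> dc dc1; elim: a b => //= x a IH b; case: eqP => [->|_].
  by case=> <-; rewrite !inE (negPf dc) (negPf dc1).
by case: (incr c a) IH => //= b' IH [<-]; rewrite !inE (IH b').
Qed.

Lemma mem_decr i a b d : d != i -> d != i.-1 -> decr i a = Some b ->
  (d \in b) = (d \in a).
Proof.
move=> di di1; elim: a b => //= x a IH b; case: (decr i a) IH => [b' IH [<-]|_].
  by rewrite !inE (IH b').
by case: eqP => // -> [<-]; case: ifP; rewrite !inE (negPf di) ?(negPf di1).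
Qed.

(** Only for [c = i.-1] does one operator create a part on which the other acts. For [c = i] they
    compete only when [i] occurs once, and then both sides are [None]. *)
Lemma incr_decrC i c a : 0 < i -> c != i.-1 ->
  obind (incr c) (decr i a) = obind (decr i) (incr c a).
Proof.
move=> i0 ci; elim: a => //= x a IH; have [xc|xc] := eqVneq x c.
  rewrite /= -xc; case E: (decr i a) => /= [b|]; first by rewrite eqxx.
  have -> : x.+1 == i = false by move: ci; rewrite -xc; lia.
  case: (eqVneq x i) => [xi|xi] //=.
  have nia : i \notin a by rewrite -decr_mem E.
  case: ifP => _ /=; rewrite -xi in i0 nia *; rewrite ?incr_None //.
  by have -> : x.-1 == x = false by lia.
case E: (decr i a) IH => [b|] /= IH.
  rewrite (negPf xc); case F: (incr c a) IH => [a2|] /= IH; last by rewrite IH.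
  rewrite -IH; case G: (incr c b) => [b2|] //=.
  case: eqP => // xi.
  have : i \in a by rewrite -decr_mem E.
  have ic : i != c by rewrite -xi.
  have ic1 : i != c.+1 by move: ci i0; lia.
  by rewrite -(mem_incr ic ic1 F) -decr_mem -IH G.
case: (eqVneq x i) => [xi|xi] /=.
  case F: (incr c a) IH => [a2|] /= IH.
    by rewrite -IH xi eqxx; case: ifP => _ //=; rewrite eq_sym (negPf ci) F.
  by case: ifP => _ //=; rewrite eq_sym (negPf ci) F.
by case: (incr c a) IH => //= a2 <-; rewrite (negPf xi).
Qed.

Lemma incr_decrK c a : 0 < c -> c.+1 \notin a ->
  obind (decr c.+1) (incr c a) = omap (fun=> a) (incr c a).
Proof.
move=> c0; elim: a => //= x a IH; rewrite inE => /norP[xc /[dup] nca /IH {}IH].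
case: eqP => [->|_] /=; first by rewrite (decr_None nca) eqxx eqSS (gtn_eqF c0).
by case: (incr c a) IH => //= a2 ->.
Qed.

Lemma decr_incrK c a : 0 < c -> c \notin a ->
  obind (incr c) (decr c.+1 a) = omap (fun=> a) (decr c.+1 a).
Proof.
move=> c0; elim: a => //= x a IH; rewrite inE => /norP[xc /[dup] nca /IH {}IH].
case: (decr _ a) IH => [b /= |_]; first by rewrite eq_sym (negPf xc) => ->.
by case: eqP => // ->; rewrite eqSS (gtn_eqF c0) /= eqxx.
Qed.

(** If the rightmost [c.+1] lies to the right of the leftmost [c], the operators touch different
    parts. Otherwise the second one undoes the first in either order, and both sides return [a]. *)
Lemma incr_decrC1 c a : 0 < c -> c \in a -> c.+1 \in a ->
  obind (incr c) (decr c.+1 a) = obind (decr c.+1) (incr c a).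
Proof.
move=> c0; elim: a => //= x a IH; rewrite !inE.
have [->|xc] /= := eqVneq c x.
  rewrite eqn_leq ltnn /= => _; rewrite -decr_mem.
  by case: (decr _ a) => //= b; rewrite eqxx.
move=> ca; have [ec _|nec c1a] /= := eqVneq c.+1 x.
  rewrite -ec in xc *; have [c1a|c1a] := boolP (c.+1 \in a).
    have := IH ca c1a; have := c1a; rewrite -decr_mem; case: (decr _ a) => //= b _.
    rewrite eq_sym (negPf xc); have [a2 e] := incr_Some ca.
    rewrite e /= => E; have := incr_mem e.
    by rewrite -decr_mem -E; case: (incr c b).
  rewrite (decr_None c1a) eqSS (gtn_eqF c0) /= eqxx.
  by have [a2 e] := incr_Some ca; have := incr_decrK c0 c1a; rewrite e /= => ->.
have := IH ca c1a; have := c1a; rewrite -decr_mem; case: (decr _ a) => //= b _.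
rewrite eq_sym (negPf xc); have [a2 ->] := incr_Some ca => /= ->.
by case: (decr _ a2) => //; rewrite eq_sym (negPf nec).
Qed.

Lemma lop_decrC i c a : 0 < i -> c != i.-1 ->
  obind (lop c) (decr i a) = obind (decr i) (lop c a).
Proof.
rewrite /lop; case: (eqVneq c 0) => [->|_]; last exact: incr_decrC.
move=> i0 i1 /=; case: (decr i a) => //=.
by have -> : 1 == i = false by lia.
Qed.

Lemma lop_decrK c a : c.+1 \notin a ->
  obind (decr c.+1) (lop c a) = omap (fun=> a) (lop c a).
Proof.
rewrite /lop; case: (posnP c) => [-> n1a /=|]; last exact: incr_decrK.
by rewrite (decr_None n1a).
Qed.

Lemma lop_decrC1 c a : (c == 0) || (c \in a) -> c.+1 \in a ->
  obind (lop c) (decr c.+1 a) = obind (decr c.+1) (lop c a).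
Proof.
rewrite /lop; case: (posnP c) => [-> _ /=|c0 /=]; last exact: incr_decrC1.
by rewrite -decr_mem; case: (decr 1 a).
Qed.

Lemma obindA (T1 T2 T3 : Type) (f : T2 -> option T3) (g : T1 -> option T2) x :
  obind f (obind g x) = obind (fun y => obind f (g y)) x.
Proof. by case: x. Qed.

Lemma lop_vopC_ge d c a : c <= d ->
  obind (lop d) (vop c.+1 a) = obind (vop c.+1) (lop d a).
Proof.
elim: c a => [|c IH] a cd; first by rewrite vop1 /=; case: (lop d a).
rewrite vopS // obindA.
have -> : obind (vop c.+2) (lop d a) = obind (vop c.+1) (obind (decr c.+1) (lop d a)).
  by rewrite obindA; case: (lop d a) => //= b; rewrite vopS.
rewrite -lop_decrC //=; last by lia.
by case: (decr _ a) => //= b; rewrite IH //; lia.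
Qed.

Lemma lop_vopC_eq c a : c.+1 \in a ->
  obind (lop c) (vop c.+2 a) = obind (vop c.+2) (lop c a).
Proof.
move=> c1a; rewrite vopS // obindA.
have -> : obind (vop c.+2) (lop c a) = obind (vop c.+1) (obind (decr c.+1) (lop c a)).
  by rewrite obindA; case: (lop c a) => //= b; rewrite vopS.
have [cok|] := boolP ((c == 0) || (c \in a)).
  rewrite -lop_decrC1 //; case: (decr _ a) => //= b; exact: lop_vopC_ge.
(* Without a part [c] both sides are [None]: on the left, [lop c] can be moved next to d_(c+1),
   which restores [a], and then d_c fails on [a]. *)
rewrite negb_or -lt0n => /andP[c0 nca].
have -> : lop c a = None by rewrite /lop gtn_eqF // incr_None.
have := decr_incrK c0 nca; case: (decr _ a) => //= b; rewrite lop_vopC_ge //.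
rewrite /lop gtn_eqF // => -> /=; case: c c0 nca {c1a} => // c _ nca.
by rewrite vopS // decr_None.
Qed.

Lemma lop_vopC_lt d c a : d < c -> (c = d.+1 -> d.+1 \in a) ->
  obind (lop d) (vop c.+1 a) = obind (vop c.+1) (lop d a).
Proof.
elim: c a => // c IH a; rewrite ltnS leq_eqVlt => /predU1P[<-|dc] h.
  exact/lop_vopC_eq/h.
rewrite vopS // obindA.
have -> : obind (vop c.+2) (lop d a) = obind (vop c.+1) (obind (decr c.+1) (lop d a)).
  by rewrite obindA; case: (lop d a) => //= b; rewrite vopS.
rewrite -lop_decrC //=; last by lia.
case E: (decr _ a) => //= [b]; rewrite IH // => e.
(* With [c = d.+1], the part [c.+1] just reduced has become a part [d.+1], so the hypothesis holds
   for [b]. *)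
elim: a b E {h IH} => //= x a IHa b; case: (decr _ a) IHa => [b2 IHa [<-]|_].
  by rewrite inE (IHa b2) ?orbT.
case: eqP => // _ [<-]; rewrite eqSS; case: eqP => [|_]; first by lia.
by rewrite inE e eqxx.
Qed.

Lemma mem_vop c a b d : c <= d -> vop c.+1 a = Some b -> (d.+1 \in b) = (d.+1 \in a).
Proof.
elim: c a => [|c IH] a cd; first by rewrite vop1 => -[->].
rewrite vopS //; case E: (decr _ a) => //= [a'] /IH -> //; last by lia.
by rewrite (mem_decr _ _ E) //=; lia.
Qed.

Lemma lop_rcons d x e : (d == x) && (x \notin e) = false ->
  lop d (rcons e x) = omap (rcons^~ x) (lop d e).
Proof.
rewrite /lop; case: (eqVneq d 0) => // _; elim: e => [|y e IH] /=.
  by case: (eqVneq d x) => // dx; rewrite eq_sym (negPf dx).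
case: (eqVneq y d) => //= yd; rewrite inE negb_or => h; rewrite IH.
  by case: (incr d e).
move: h; case: (eqVneq d x) => //= <-; by rewrite eq_sym yd.
Qed.

Lemma lop_rcons_new c e : 0 < c -> c \notin e -> lop c (rcons e c) = Some (rcons e c.+1).
Proof.
move=> c0; rewrite /lop gtn_eqF //; elim: e => [|y e IH] /=; first by rewrite eqxx.
by rewrite inE eq_sym => /norP[/negPf -> /IH ->].
Qed.

(** The exchange rule. The appended part [c.+1] is the only one of its size, so [lop c.+1] raises it
    to [c.+2]. On the other side [lop c] creates the only part [c.+1], and d_(c+1) undoes this at
    once. *)
Lemma lop_uop_new c a : c.+1 \notin a ->
  obind (lop c.+1) (uop c.+1 a) = obind (uop c.+2) (lop c a).
Proof.
move=> nca; have -> : obind (uop c.+2) (lop c a) =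
    omap (rcons^~ c.+2) (obind (vop c.+1) (obind (decr c.+1) (lop c a))).
  by rewrite obindA; case: (lop c a) => //= b; rewrite /uop vopS.
rewrite lop_decrK // /uop; case E: (vop _ a) => [b|] /=.
  rewrite lop_rcons_new ?(mem_vop (leqnn c) E) //.
  (* For [c > 0] the first factor of [vop c.+1] is d_c; its success provides the part [c] that
     [lop c] needs. *)
  have : isSome (lop c a); last by case: (lop c a) => //= b' _; rewrite E.
  rewrite /lop; case: c E nca => //= c; rewrite vopS // => + _.
  case F: (decr _ a) => [a'|] //= _.
  by have /incr_Some[b' ->] : c.+1 \in a by rewrite -decr_mem F.
by case: (lop c a) => //= b'; rewrite E.
Qed.

(** The two excluded cases are the two sides of the exchange rule [lop_uop_new]; in all others the
    operators commute. *)
Lemma lop_uopC d c a : ~~ ((d == c.+1) && (c.+1 \notin a)) ->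
  ~~ ((c == d.+1) && (d.+1 \notin a)) ->
  obind (lop d) (uop c.+1 a) = obind (uop c.+1) (lop d a).
Proof.
move=> h1 h2.
have -> : obind (uop c.+1) (lop d a) = omap (rcons^~ c.+1) (obind (vop c.+1) (lop d a)).
  by case: (lop d a).
have <- : obind (lop d) (vop c.+1 a) = obind (vop c.+1) (lop d a).
  have [cd|dc] := leqP c d; first exact: lop_vopC_ge.
  apply: lop_vopC_lt => // e; move: h2; rewrite e eqxx /=; by rewrite negbK.
rewrite /uop; case E: (vop _ a) => [b|] //=; rewrite lop_rcons //.
by rewrite (mem_vop (leqnn c) E); apply/negbTE.
Qed.

(** * Column words *)

(** The last letter acts first: the box of the largest entry is placed first and the box of 1
    last. *)
Definition shp (w : seq nat) : option (seq nat) :=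
  foldr (fun c => obind (lop c)) (Some [::]) w.

(** The parts are the lengths of the maximal strictly decreasing runs of [w], since the descents are
    the weak ascents. *)
Fixpoint cdesc (w : seq nat) : seq nat :=
  if w is c :: w' then
    if (w' == [::]) || (c <= head 0 w') then 1 :: cdesc w'
    else (head 0 (cdesc w')).+1 :: behead (cdesc w')
  else [::].

(** The near-concatenation b(.)1, with the default value [[::]] for the empty composition. *)
Definition inclast (b : seq nat) : seq nat :=
  if b is x :: s then rcons (belast x s) (last x s).+1 else [::].

Lemma sumn_lop c a b : lop c a = Some b -> sumn b = (sumn a).+1.
Proof.
rewrite /lop; case: eqP => [_ [<-] //|_]; elim: a b => //= x a IH b.
case: eqP => [-> [<-] //|_]; case: (incr c a) IH => //= d IH [<-] /=.
by rewrite (IH d) // addnS.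
Qed.

Lemma lop_le c a b : lop c a = Some b -> c <= sumn a.
Proof.
rewrite /lop; case: eqP => [-> //|_]; elim: a b => //= x a IH b.
case: eqP => [-> _|_]; first exact: leq_addr.
case: (incr c a) IH => //= d /(_ d erefl) le _; exact: leq_trans le (leq_addl _ _).
Qed.

Lemma lop_comp c a b : lop c a = Some b -> is_comp a -> is_comp b.
Proof.
rewrite /lop; case: eqP => [_ [<-] //|_]; elim: a b => //= x a IH b.
case: eqP => [_ [<-] /andP[_] //|_]; case: (incr c a) IH => //= d IH [<-] /andP[x0 /(IH d erefl)] /=.
by rewrite x0.
Qed.

Lemma shp_comps w a : shp w = Some a -> a \in comps (size w).
Proof.
rewrite mem_comps; elim: w a => [|c w IH] a /=; first by case=> <-.
case: (shp w) IH => //= d /(_ d erefl)/andP[pd /eqP sd] ca.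
by rewrite (lop_comp ca pd) (sumn_lop ca) sd eqxx.
Qed.

Lemma shp_bound w a : shp w = Some a -> all (fun c => c < size w) w.
Proof.
elim: w a => [|c w IH] a /=; first by [].
case E: (shp w) IH => [d|] //= /(_ d erefl) aw ca.
have := shp_comps E; rewrite mem_comps => /andP[_ /eqP sd].
rewrite ltnS -sd (lop_le ca) /=; apply: sub_all aw => x /=; lia.
Qed.

Lemma shp_rcons0 w c a : shp (rcons w c) = Some a -> c = 0.
Proof.
elim: w a => [|d w IH] a /=; first by rewrite /lop; case: eqP.
by case: (shp (rcons w c)) IH => // g /(_ g erefl).
Qed.

Lemma cdesc_comps w : cdesc w \in comps (size w).
Proof.
rewrite mem_comps; elim: w => //= c w /andP[pw sw].
case: ifP => [_|/negbT]; first by rewrite /= pw add1n eqSS sw.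
case: w pw sw => // d w; case: (cdesc _) => //= x r /andP[_ ->] /=.
by rewrite addSn eqSS => ->.
Qed.

Lemma cdesc_nil w : (cdesc w == [::]) = (w == [::]).
Proof. by case: w => //= c w; case: ifP. Qed.

Lemma cdesc_cons c w : cdesc (c :: w) =
  if (w == [::]) || (c <= head 0 w) then 1 :: cdesc w
  else (head 0 (cdesc w)).+1 :: behead (cdesc w).
Proof. by []. Qed.

Lemma cdesc_rcons w c : w != [::] -> cdesc (rcons w c) =
  if last 0 w <= c then rcons (cdesc w) 1 else inclast (cdesc w).
Proof.
elim: w => // d [_ _|e w /(_ isT) IH _]; first by rewrite /=; case: ifP.
rewrite rcons_cons cdesc_cons IH [cdesc (d :: e :: w)]cdesc_cons.
have := cdesc_nil (e :: w); case: (cdesc _) => // x r _.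
by rewrite /=; case: ifP => _; case: ifP => _ //=; case: r.
Qed.

Lemma inclast_inj b d : b != [::] -> d != [::] -> inclast b = inclast d -> b = d.
Proof.
case: b d => [|x b] [|y d] // _ _ /= /rcons_inj[e1 e2].
by rewrite [_ :: b]lastI [_ :: d]lastI e1 e2.
Qed.

Lemma inclast_last b : b != [::] -> last 0 (inclast b) = (last 0 b).+1.
Proof. by case: b => //= x b _; rewrite last_rcons. Qed.

Lemma last_comp b : is_comp b -> b != [::] -> 0 < last 0 b.
Proof. by case: b => // x b /allP pb _; apply: pb; apply: mem_last. Qed.

Lemma cdesc_rconsP w c b : is_comp b -> size w = sumn b ->
  (cdesc (rcons w c) == rcons b 1) || (cdesc (rcons w c) == inclast b)
  = (cdesc w == b).
Proof.
move=> pb sw; have [w0|wn] := eqVneq w [::].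
  by move: sw; rewrite w0; case: b pb => [|[|x] b].
have bn : b != [::] by apply: contraNneq wn => b0; rewrite b0 in sw; case: (w) sw.
have cn : cdesc w != [::] by rewrite cdesc_nil.
have pc : is_comp (cdesc w) by have := cdesc_comps w; rewrite mem_comps => /andP[].
have ne x y : is_comp x -> x != [::] -> rcons y 1 != inclast x.
  move=> px xn; apply/eqP => /(congr1 (last 0)); rewrite last_rcons inclast_last //.
  by have := last_comp px xn; lia.
rewrite cdesc_rcons //; case: ifP => _.
  rewrite (negPf (ne _ _ pb bn)) orbF; apply/eqP/eqP => [/rcons_inj[]|->] //.
rewrite [in X in X || _]eq_sym (negPf (ne _ _ pc cn)) /=.
by apply/eqP/eqP => [/inclast_inj ->|->].
Qed.

(** * Sliding a right operator through a column word *)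

Definition sh (v : seq nat) : seq nat := odflt [::] (shp v).

(* [slide w v s]: moving [uop 1] leftwards past the operators [lop c] of the word w turns
   w into v and [uop 1] into [uop s.+1]. *)
Inductive slide : seq nat -> seq nat -> nat -> Prop :=
| slide_nil : slide [::] [::] 0
| slide_swap w v s : slide w v s -> s.+1 \notin sh v ->
    slide (s.+1 :: w) (s :: v) s.+1
| slide_keep c w v s : slide w v s ->
    ~~ ((c == s.+1) && (s.+1 \notin sh v)) ->
    ~~ ((s == c.+1) && (c.+1 \notin sh v)) -> slide (c :: w) (c :: v) s.

(** [phi] computes [slide] from [w], and [psi] recovers [w] from [v] and the final index [s];
    together they make [slide] the graph of a bijection. *)
Fixpoint phi (w : seq nat) : seq nat * nat :=
  if w is c :: w' then
    let: (v, s) := phi w' in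
    if (c == s.+1) && (s.+1 \notin sh v) then (s :: v, s.+1) else (c :: v, s)
  else ([::], 0).

Fixpoint psi (v : seq nat) (s : nat) : seq nat :=
  if v is c :: v' then
    if (s == c.+1) && (c.+1 \notin sh v') then s :: psi v' c else c :: psi v' s
  else [::].

Lemma slide_phi w v s : slide w v s -> phi w = (v, s).
Proof.
elim=> //= [{}w {}v {}s _ -> -> | c {}w {}v {}s _ -> /negPf ->] //.
by rewrite eqxx.
Qed.

Lemma slide_psi w v s : slide w v s -> psi v s = w.
Proof.
elim=> //= [{}w {}v {}s _ -> -> | c {}w {}v {}s _ -> _ /negPf ->] //.
by rewrite eqxx.
Qed.

Lemma slide_size w v s : slide w v s -> size w = size v.
Proof. by elim=> //= > _ ->. Qed.

(** The final letter 0 acts on the empty composition as [uop 1] does; each further letter is one use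
    of the exchange rule or of commutation. *)
Lemma slide_shp w v s : slide w v s ->
  shp (rcons w 0) = obind (uop s.+1) (shp v).
Proof.
elim=> [//|{}w {}v {}s _ IH|c {}w {}v {}s _ IH]; rewrite /sh => h1.
  rewrite rcons_cons /= IH; case E: (shp v) h1 => [a|] //=; exact: lop_uop_new.
by rewrite rcons_cons /= IH; case E: (shp v) h1 => [a|] //= *; apply: lop_uopC.
Qed.

Lemma uop_None c a : c.+1 \notin a -> uop c.+2 a = None.
Proof. by move=> nca; rewrite /uop vopS // decr_None. Qed.

Lemma phi_slide w g : shp (rcons w 0) = Some g -> slide w (phi w).1 (phi w).2.
Proof.
elim: w g => [|c w IH] g; first by move=> _; constructor.
rewrite rcons_cons /=; case E: (shp (rcons w 0)) IH => [h|] //= /(_ h erefl).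
case: (phi w) => v s /= sl cg.
case: ifP => [/andP[/eqP -> nsv]|/negbT ncs]; first exact: slide_swap.
(* If [s = c.+1] and [sh v] had no part [c.+1], then [uop s.+1] would begin with d_(c+1) and fail,
   although the shape is defined. *)
apply: slide_keep => //; apply/negP => /= /andP[/eqP sc].
have := slide_shp sl; rewrite E /sh sc; case: (shp v) => //= a e ca.
by rewrite uop_None in e.
Qed.

Lemma psi_slide v s g : obind (uop s.+1) (shp v) = Some g -> slide (psi v s) v s.
Proof.
elim: v s g => [|c v IH] s g /=.
  by case: s => [|s]; [constructor | rewrite uop_None].
case E: (shp v) IH => [a|] //= IH h; have sa : sh v = a by rewrite /sh E.
case: ifP => [/andP[/eqP sc nc]|/negbT ncs].
  rewrite sc in h *; apply: slide_swap => //.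
  move: h; rewrite -lop_uop_new -?sa // sa.
  case F: (uop _ a) => [g'|] //= _; exact: IH F.
(* A letter [s.+1] without a part [s.+1] to raise would leave [c :: v] without a shape. *)
have nsc : ~~ ((c == s.+1) && (s.+1 \notin sh v)).
  rewrite sa; apply/negP => /andP[/eqP cs nsa]; move: h.
  by rewrite cs /lop /= incr_None.
apply: slide_keep => //; move: h; rewrite sa in ncs nsc; rewrite -lop_uopC //.
case F: (uop _ a) => [g'|] //= _; exact: IH F.
Qed.

Lemma slide_last w v s g : slide w v s -> shp (rcons w 0) = Some g -> (last 0 g).-1 = s.
Proof.
move=> /slide_shp ->; case: (shp v) => //= a; rewrite /uop.
by case: (vop _ a) => //= b [<-]; rewrite last_rcons.
Qed.

Lemma lop_mem c a b : lop c a = Some b -> c.+1 \in b.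
Proof. by rewrite /lop; case: eqP => [-> [<-]|_]; [rewrite inE | apply: incr_mem]. Qed.

(** Descents depend on comparisons of adjacent letters. Replacing [s.+1] by [s] could alter one only
    if the unchanged next letter is [s] or the unchanged previous letter is [s.+1]; the shapes rule
    out both. *)
Lemma slide_cdesc w v s g : slide w v s -> shp (rcons w 0) = Some g ->
  cdesc w = cdesc v.
Proof.
have cons c d x y : cdesc x = cdesc y ->
    (x == [::]) || (c <= head 0 x) = (y == [::]) || (d <= head 0 y) ->
    cdesc (c :: x) = cdesc (d :: y).
  by rewrite !cdesc_cons => -> ->.
move=> sl; elim: sl g => [//|{}w {}v {}s sl IH nsv|c {}w {}v {}s sl IH n1 n2] g;
  rewrite rcons_cons /=; case E: (shp (rcons w 0)) IH => [h|] //= /(_ h erefl) /cons IH ch.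
  apply: IH; case: sl E nsv {ch} => {w v s} [//|w v s _ _ _ _|d w v s sl _ _] /=.
    by lia.
  rewrite (slide_shp sl); case Ev: (shp v) => [a|] //= Ew.
  rewrite /sh /= Ev /= => nsd; rewrite ltn_neqAle; case: (eqVneq s d) => //= ds.
  (* A next letter [s] would have left a part [s.+1] in the shape, which the swap forbids. *)
  move: nsd; rewrite -{d}ds lop_uopC ?andbF //= in Ew *; last 2 first.
    by rewrite eqn_leq leqnSn ltnn.
    by rewrite eqn_leq leqnSn ltnn.
  by case F: (lop s a) Ew => [b|] //= _; rewrite (lop_mem F).
apply: IH; case: sl E ch n1 n2 => {w v s} [//|w v s sl nsv|d w v s sl _ _] //=.
rewrite (slide_shp sl) /sh /=; case Ev: (shp v) nsv => [a|] //=; rewrite /sh Ev /= => nsa.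
move=> ah hg _ _; rewrite leq_eqVlt; case: eqP => //= cs; exfalso.
move: ah; rewrite /uop; case Ea: (vop s.+1 a) => [b|] //=.
(* After the exchange the shape is [b] followed by [s.+2], so a previous letter [s.+1] would find no
   part to raise. *)
have nsb : s.+1 \notin b by rewrite (mem_vop (leqnn s) Ea).
rewrite lop_rcons_new // => -[eh]; move: hg; rewrite cs -eh /lop /= incr_None //.
by rewrite mem_rcons inE negb_or nsb eqn_leq ltnn andbF.
Qed.

(** * Counting column words by shape and descents *)

(** A finite pool containing, for [m <= N], every word of length [m] that has a shape. The free
    bound [N] lets two consecutive degrees share the alphabet. *)
Fixpoint words (N m : nat) : seq (seq nat) :=
  if m is m'.+1 then [seq c :: w | c <- iota 0 N, w <- words N m'] else [:: [::]].

Lemma mem_words N m w : (w \in words N m) = (size w == m) && all (fun c => c < N) w.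
Proof.
elim: m w => [|m IH] [|c w] //=; first by apply/negbTE/allpairsP => -[[]] /= ? ? [].
apply/allpairsP/idP => [[[d v] /= [+ + [-> ->]]]|].
  by rewrite mem_iota IH eqSS => /= -> /andP[-> ->].
rewrite eqSS => /and3P[sw cN aw]; exists (c, w); split => //=.
  by rewrite mem_iota.
by rewrite IH sw.
Qed.

Lemma uniq_words N m : uniq (words N m).
Proof.
elim: m => //= m IH; apply: allpairs_uniq; rewrite ?iota_uniq //.
by move=> [c w] [d v] _ _ /= [-> ->].
Qed.

Lemma sh_words N m w a : m <= N -> size w = m -> shp w = Some a -> w \in words N m.
Proof.
move=> mN sw /shp_bound; rewrite mem_words sw eqxx /=.
by apply: sub_all => c /= /leq_trans; apply.
Qed.

Lemma uop_last i a g : uop i a = Some g -> last 0 g = i.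
Proof. by rewrite /uop; case: (vop i a) => //= b [<-]; rewrite last_rcons. Qed.

Lemma covbP a g : reflect (exists s, uop s.+1 a = Some g) (covb a g).
Proof.
apply: (iffP hasP) => [[[|s]]|[s e]]; rewrite ?mem_iota //.
  by move=> _ /eqP e; exists s.
exists s.+1; last by rewrite e.
rewrite mem_iota /= add1n ltnS.
by move: e; rewrite /uop; case: (vop _ a) => //= b [<-]; rewrite sumn_rcons leq_addl.
Qed.

(** The bijection deletes the final letter, necessarily 0, and slides. For the way back, [s] is read
    off [g], whose last part is the [s.+1] appended by [uop s.+1]. *)
Lemma count_slide N m g b : m < N -> b \in comps m ->
  count (fun w => (shp w == Some g) &&
      ((cdesc w == rcons b 1) || (cdesc w == inclast b))) (words N m.+1) =
  count (fun v => (if shp v is Some a then covb a g else false) && (cdesc v == b))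
    (words N m).
Proof.
move=> mN; rewrite mem_comps => /andP[pb /eqP sb].
apply: (@count_bij _ _ _ _ _ _ (fun w => (phi (take m w)).1)
  (fun v => rcons (psi v (last 0 g).-1) 0)); rewrite ?uniq_words //.
  move=> w; rewrite mem_words => /andP[/eqP sw _]; case: (lastP w) sw => // {}w c.
  rewrite size_rcons => -[sw] /andP[/eqP hw]; have c0 := shp_rcons0 hw; subst c.
  rewrite cdesc_rconsP ?sw // => /eqP cb.
  rewrite -sw -cats1 take_size_cat // cats1; have sl := phi_slide hw.
  have sv := slide_size sl; rewrite -(slide_cdesc sl hw) cb eqxx andbT.
  rewrite (slide_last sl hw) (slide_psi sl).
  have := slide_shp sl; rewrite hw; case E: (shp _) => [a|] //= e.
  split=> //; last by apply/covbP; exists (phi w).2; rewrite -e.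
  by apply: sh_words E => //; rewrite sw ltnW.
move=> v; rewrite mem_words => /andP[/eqP sv _].
case E: (shp v) => [a|] //= /andP[/covbP[s e] /eqP cb].
have := @psi_slide v s g; rewrite E /= (uop_last e) => /(_ e) sl /=.
have hw : shp (rcons (psi v s) 0) = Some g by rewrite (slide_shp sl) E.
have sw := slide_size sl.
rewrite hw eqxx cdesc_rconsP ?sw ?sv // (slide_cdesc sl hw) cb eqxx; split => //.
  by apply: (@sh_words N m.+1 _ g) => //; rewrite ?size_rcons ?sw ?sv.
by rewrite -cats1 take_size_cat ?sw // (slide_phi sl).
Qed.

Definition wcount N m a b := count (fun w => (shp w == Some a) && (cdesc w == b)) (words N m).

Lemma wcount_slide N m g b : m < N -> b \in comps m ->
  wcount N m.+1 g (rcons b 1) + wcount N m.+1 g (inclast b) =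
  \sum_(a <- comps m) covb a g * wcount N m a b.
Proof.
move=> mN bm; have h := count_slide g mN bm.
have pb : is_comp b by move: bm; rewrite mem_comps => /andP[].
have ne : rcons b 1 != inclast b.
  apply/eqP => /(congr1 (last 0)); case: b pb {bm h} => // x b pb.
  by rewrite last_rcons inclast_last //; have := last_comp pb isT; lia.
rewrite {1 2}/wcount -count_predUI [X in _ + X](_ : _ = 0); last first.
  transitivity (count pred0 (words N m.+1)); last exact: count_pred0.
  apply: eq_count => w /=.
  case: eqP => //= _; case: (eqVneq (cdesc w) (rcons b 1)) => [->|] //=.
  by rewrite (negPf ne).
rewrite addn0 (eq_count (a2 := fun w => (shp w == Some g) &&
      ((cdesc w == rcons b 1) || (cdesc w == inclast b)))); last first.
  by move=> w /=; rewrite andb_orr.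
rewrite {}h -sum1_count big_mkcond /=; under [RHS]eq_bigr => a _.
  rewrite /wcount -sum1_count big_mkcond big_distrr; over.
rewrite exchange_big /= big_seq [RHS]big_seq; apply: eq_bigr => v.
rewrite mem_words => /andP[/eqP sv _]; case E: (shp v) => [a|] /=; last first.
  by rewrite big1 // => a _; rewrite muln0.
have am : a \in comps m by rewrite -sv; apply: shp_comps.
rewrite (bigD1_seq a) ?uniq_comps //= eqxx big1 ?addn0.
  by case: (covb a g); case: (_ == b).
by move=> d da; rewrite -[Some a == _]/(a == d) eq_sym (negPf da) muln0.
Qed.

(** * Tableaux and column words *)

Lemma iota1S m : iota 1 m.+1 = 1 :: map S (iota 1 m).
Proof. by rewrite /= -(iotaDl 1 1). Qed.

Lemma pairmap_subS x s :
  pairmap (fun x y => y - x) x.+1 (map S s) = pairmap (fun x y => y - x) x s.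
Proof. by elim: s x => //= y s IH x; rewrite subSS IH. Qed.

(** Induction with [f] shifted: the first comparison decides whether 1 is a descent, and the rest is
    the word of [f \o S]. *)
Lemma cdescE (f : nat -> nat) m :
  set_to_comp m [seq j <- iota 1 m.-1 | f j <= f j.+1] = cdesc [seq f v | v <- iota 1 m].
Proof.
elim: m f => [|[|m] IH] f //.
pose D := [seq j <- iota 1 m | (f \o S) j <= (f \o S) j.+1].
have -> : [seq j <- iota 1 m.+2.-1 | f j <= f j.+1] =
    (if f 1 <= f 2 then [:: 1] else [::]) ++ map S D.
  by rewrite iota1S /= filter_map; case: ifP.
rewrite iota1S map_cons cdesc_cons -map_comp -(IH (f \o S)) -/D.
have -> : ([seq (f \o succn) i | i <- iota 1 m.+1] == [::]) = false by [].
rewrite /set_to_comp [m.+2 == 0]/= [m.+1 == 0]/=.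
rewrite orFb [head 0 _]/=; case: ifP => _.
  by rewrite -[LHS]/(1 :: pairmap _ 1 (rcons (map S D) m.+2)) -map_rcons pairmap_subS.
by rewrite -map_rcons; case: D => [|x D] /=; rewrite ?subn0 // pairmap_subS.
Qed.

Definition wordof (m : nat) (T : seq (seq nat)) := [seq colof T v | v <- iota 1 m].

Lemma colof_cons row T v :
  colof (row :: T) v = if v \in row then index v row else colof T v.
Proof. by rewrite /colof /=; case: ifP. Qed.

(** * Inserting and deleting the entry 1 of a tableau *)

Definition shift (T : seq (seq nat)) := map (map S) T.

(** Tableau counterpart of [incr]: the old entries grow by 1 and a new entry 1 ends the first row of
    length [c]. Likewise [ins] follows [lop]. *)
Fixpoint insr (c : nat) (T : seq (seq nat)) : seq (seq nat) :=
  if T is row :: T' then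
    if size row == c then rcons (map S row) 1 :: shift T' else map S row :: insr c T'
  else [::].

Definition ins (c : nat) (T : seq (seq nat)) : seq (seq nat) :=
  if c == 0 then [:: 1] :: shift T else insr c T.

Lemma shape_shift T : shape (shift T) = shape T.
Proof. by rewrite /shape -map_comp; apply: eq_map => r /=; rewrite size_map. Qed.

Lemma shape_ins c T a : lop c (shape T) = Some a -> shape (ins c T) = a.
Proof.
rewrite /lop /ins; case: eqP => [_ [<-]|_]; first by rewrite /= shape_shift.
elim: T a => //= row T IH a; case: eqP => [<- [<-]|_] /=.
  by rewrite size_rcons size_map shape_shift.
by case: (incr c _) IH => //= d /(_ d erefl) -> [<-]; rewrite size_map.
Qed.

Lemma flatten_shift T : flatten (shift T) = map S (flatten T).
Proof. by rewrite map_flatten. Qed.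

Lemma perm_ins c T m a : lop c (shape T) = Some a ->
  perm_eq (flatten (ins c T)) (iota 1 m.+1) = perm_eq (flatten T) (iota 1 m).
Proof.
move=> ca; have e : perm_eq (flatten (ins c T)) (1 :: map S (flatten T)).
  move: ca; rewrite /lop /ins; case: eqP => [_ _|_]; first by rewrite /= flatten_shift.
  elim: T a => //= row T IH a; case: eqP => [<- _|_] /=.
    by rewrite flatten_shift cat_rcons perm_catC /= perm_cons perm_catC map_cat.
  case: (incr c _) IH => //= d /(_ d erefl) h _.
  by rewrite (perm_catl _ h) map_cat perm_catC /= perm_cons perm_catC.
rewrite iota1S (permPl e) perm_cons; apply/idP/idP; last exact: perm_map.
exact/perm_map_inj/succn_inj.
Qed.

Lemma index_rcons (T : eqType) (x y : T) s : x \in s -> index x (rcons s y) = index x s.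
Proof. by move=> xs; rewrite -cats1 index_cat xs. Qed.

Lemma colof_shift T v : colof (shift T) v.+1 = colof T v.
Proof.
elim: T => //= row T IH; rewrite !colof_cons IH mem_map ?index_map //; exact: succn_inj.
Qed.

Lemma colof_insS c T v : 0 < v -> v \in flatten T -> colof (ins c T) v.+1 = colof T v.
Proof.
move=> v0 vT; rewrite /ins; case: eqP => _.
  rewrite colof_cons colof_shift inE eqSS (gtn_eqF v0) //.
elim: T {vT} => //= row T IH; have vr := mem_map succn_inj row v.
case: ifP => _; rewrite !colof_cons ?mem_rcons ?inE ?eqSS ?(gtn_eqF v0) /= vr.
  rewrite colof_shift; case: ifP => // h.
  by rewrite index_rcons ?vr // index_map //; exact: succn_inj.
by rewrite IH index_map //; exact: succn_inj.
Qed.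

Lemma colof_ins1 c T a : 0 \notin flatten T -> lop c (shape T) = Some a ->
  colof (ins c T) 1 = c.
Proof.
have S0 row : 0 \notin row -> 1 \notin map S row.
  by move=> n0; rewrite mem_map //; exact: succn_inj.
move=> nT; rewrite /lop /ins; case: eqP => [-> _|_]; first by rewrite colof_cons inE.
elim: T a nT => //= row T IH a; rewrite mem_cat negb_or => /andP[n0 nT].
case: eqP => [<- _|_] /=.
  rewrite colof_cons mem_rcons inE eqxx -cats1 index_cat (negPf (S0 _ n0)) /=.
  by rewrite addn0 size_map.
by case: (incr c _) IH => //= d /(_ d nT erefl) h _; rewrite colof_cons (negPf (S0 _ n0)).
Qed.

(** The value 0 stands for a missing box, so shifting the entries has to fix it. *)
Definition up x := if x is 0 then 0 else x.+1.

Lemma ent_cons row T r c : ent (row :: T) r c = if r is r'.+1 then ent T r' c else nth 0 row c.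
Proof. by case: r. Qed.

Lemma nth_up row j : 0 \notin row -> nth 0 (map S row) j = up (nth 0 row j).
Proof.
move=> n0; have [lt|ge] := ltnP j (size row); last by rewrite !nth_default ?size_map.
rewrite (nth_map 0) //; case E: (nth 0 row j) => //.
by move: n0; rewrite -E mem_nth.
Qed.

Lemma ent_shift T r j : 0 \notin flatten T -> ent (shift T) r j = up (ent T r j).
Proof.
elim: T r => [|row T IH] r /=; first by rewrite /ent !nth_nil.
by rewrite mem_cat negb_or !ent_cons => /andP[n0 nT]; case: r => [|r]; rewrite ?nth_up ?IH.
Qed.

Lemma ent_insr c T r j : 0 \notin flatten T -> ent (insr c T) r j =
  if (r == index c (shape T)) && (j == c) && (c \in shape T) then 1 else up (ent T r j).
Proof.
elim: T r => [|row T IH] r /=; first by rewrite andbF /ent !nth_nil.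
rewrite mem_cat negb_or inE => /andP[n0 nT]; rewrite [c == _]eq_sym.
case: eqP => [sr|_] /=; rewrite !ent_cons; case: r => [|r].
- rewrite nth_rcons size_map sr andbT /=; case: ltngtP => [lt|gt|_] //.
    by rewrite nth_up.
  by rewrite nth_default // sr ltnW.
- by rewrite ent_shift.
- by rewrite nth_up.
by rewrite IH // eqSS.
Qed.

(** The SRCT conditions in terms of [ent]: positivity of an entry replaces the tests on row lengths,
    which turns each case into linear arithmetic. *)
Record good (m : nat) (T : seq (seq nat)) : Prop := Good {
  good_nil : [::] \notin T;
  good_perm : perm_eq (flatten T) (iota 1 m);
  good_row : forall r j, 0 < ent T r j.+1 -> ent T r j.+1 < ent T r j;
  good_col : forall r, 0 < ent T r.+1 0 -> ent T r 0 < ent T r.+1 0;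
  good_tri : forall r s j, r < s -> 0 < ent T s j.+1 ->
    ent T s j.+1 < ent T r j -> ent T s j.+1 < ent T r j.+1 }.

Lemma good_pos m T : good m T -> 0 \notin flatten T.
Proof. by move=> g; rewrite (perm_mem (good_perm g)) mem_iota. Qed.

Lemma ent_gt0 T r j : 0 \notin flatten T -> (0 < ent T r j) = (j < size (nth [::] T r)).
Proof.
move=> n0; have [lt|ge] := ltnP j (size _); last by rewrite /ent nth_default.
rewrite lt0n; apply: contraNneq n0 => <-; apply/flattenP; exists (nth [::] T r); last exact: mem_nth.
by apply: mem_nth; rewrite ltnNge; apply: contraL lt => /(nth_default [::]) ->.
Qed.

Lemma size_nth_flatten (T : seq (seq nat)) s : size (nth [::] T s) <= size (flatten T).
Proof.
elim: T s => [|row T IH] [|s] //=; rewrite size_cat ?leq_addr //.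
exact: leq_trans (IH s) (leq_addl _ _).
Qed.

Lemma SRCT_good m T : [::] \notin T -> perm_eq (flatten T) (iota 1 m) ->
  is_SRCT m T <-> good m T.
Proof.
move=> nT pT; have n0 : 0 \notin flatten T by rewrite (perm_mem pT) mem_iota.
split => [/and3P[/all_nthP-/(_ [::]) rT cT tT]|g].
  split => // [r j|r|r s j rs].
  - rewrite ent_gt0 // => lt; have rlt : r < size T.
      by rewrite ltnNge; apply: contraL lt => /(nth_default [::]) ->.
    exact: (sortedP 0 (rT r rlt)).
  - rewrite ent_gt0 // => lt; have rlt : r.+1 < size T.
      by rewrite ltnNge; apply: contraL lt => /(nth_default [::]) ->.
    have := sortedP 0 cT r; rewrite size_map => /(_ rlt).
    by rewrite !(nth_map [::]) ?(ltnW rlt) // /ent !nth0.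
  rewrite ent_gt0 // => lt h.
  have slt : s < size T.
    by rewrite ltnNge; apply: contraL lt => /(nth_default [::]) ->.
  (* [is_SRCT] tests only columns below [m]; this suffices because no row is longer than the number
     of entries. *)
  have jm : j < m.
    rewrite -(size_iota 1 m) -(perm_size pT); apply: leq_trans (ltnW lt) _.
    exact: size_nth_flatten.
  move: tT => /allP/(_ s); rewrite mem_iota => /(_ slt)/allP/(_ r); rewrite mem_iota.
  by move=> /(_ rs)/allP/(_ j); rewrite mem_iota => /(_ jm); rewrite lt h.
case: g => _ _ gr gc gt; apply/and3P; split.
- apply/(all_nthP [::]) => r _; apply/(sortedP 0) => j lt; apply: gr.
  by rewrite ent_gt0.
- apply/(sortedP 0) => r; rewrite size_map => lt.
  rewrite !(nth_map [::]) ?(ltnW lt) // -!nth0; apply: gc.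
  rewrite ent_gt0 // lt0n size_eq0; apply: contraNneq nT => <-; exact: mem_nth.
apply/allP => s _; apply/allP => r; rewrite mem_iota => rs; apply/allP => j _.
by apply/implyP => lt; apply/implyP => h; apply: gt; rewrite ?ent_gt0.
Qed.

Lemma upE x : up x = x + (0 < x).
Proof. by case: x => // x; rewrite addn1. Qed.

Lemma ent_index c T j : 0 \notin flatten T -> c \in shape T ->
  (0 < ent T (index c (shape T)) j) = (j < c).
Proof.
move=> n0 cT; rewrite ent_gt0 // -[in RHS](nth_index 0 cT) (nth_map [::]) //.
by rewrite -(size_map size) index_mem.
Qed.

Lemma good_ins c T m a : good m T -> lop c (shape T) = Some a -> good m.+1 (ins c T).
Proof.
move=> g ca; have n0 := good_pos g; have pT := perm_ins m ca; rewrite (good_perm g) in pT.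
case: g => nT _ gr gc gt; move: ca pT; rewrite /lop /ins; case: (posnP c) => [_ _|c0 ca] pT.
  have E r j : ent ([:: 1] :: shift T) r j =
      if r is r'.+1 then ent T r' j + (0 < ent T r' j) else (j == 0).
    by rewrite ent_cons; case: r => [|r]; [case: j => // j; rewrite nth_default | rewrite ent_shift // upE].
  split => //.
  - rewrite inE /=; apply: contra nT => /mapP[[|x row] //].
  - move=> [|r] j; rewrite !E //; have := gr r j; lia.
  - move=> [|r]; rewrite !E; [lia | have := gc r; lia].
  by move=> [|r] [|s] j; rewrite !E //; [lia | have := gt r s j; lia].
set k := index c (shape T).
have cT : c \in shape T by apply/negPn/negP => /incr_None; rewrite ca.
have E r j : ent (insr c T) r j =
    if (r == k) && (j == c) then 1 else ent T r j + (0 < ent T r j).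
  by rewrite ent_insr // cT andbT upE.
have ekj j : (0 < ent T k j) = (j < c) by apply: ent_index.
(* No row above [k] has length [c], so one that reaches column [c.-1] also reaches column [c]. This
   gives the triple condition for the new entry 1. *)
have erj r j : r < k -> 0 < ent T r j -> j.+1 = c -> 0 < ent T r j.+1.
  move=> rk + jc; rewrite !ent_gt0 // => lt; rewrite ltn_neqAle lt andbT.
  have /negbT : pred1 c (nth 0 (shape T) r) = false by apply: before_find.
  have kT : k < size T by move: cT; rewrite -index_mem size_map.
  by rewrite (nth_map [::]) ?(ltn_trans rk) // jc eq_sym /=.
split => //.
- have : 0 \notin shape (insr c T).
    have := @lop_comp c (shape T) a.
    have := @shape_ins c T a; rewrite /ins /lop gtn_eqF // => /(_ ca) -> /(_ ca) h.
    have /h/allP pa : is_comp (shape T).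
      apply/allP => x /mapP[row rT ->]; rewrite lt0n size_eq0; by apply: contraNneq nT => <-.
    by apply/negP => /pa.
  by apply: contra => /(map_f size).
- move=> r j; rewrite !E; have := gr r j; have := ekj j; have := ekj j.+1.
  case: (eqVneq r k) => [->|_] /=; last by lia.
  by case: (eqVneq j.+1 c) => jc1; case: (eqVneq j c) => jc /=; lia.
- move=> r; rewrite !E [0 == c]eq_sym (gtn_eqF c0) !andbF; have := gc r; lia.
move=> r s j rs; rewrite !E; have := gt r s j rs; have := ekj j; have := ekj j.+1.
have := @erj r j; have := @gr s j.
case: (eqVneq s k) rs => [->|_]; case: (eqVneq r k) => [->|_] /= rs;
  by case: (eqVneq j.+1 c) => jc1; case: (eqVneq j c) => jc /=; lia.
Qed.

Lemma shift_pred T : 0 \notin flatten T -> shift (map (map predn) T) = T.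
Proof.
move=> n0; rewrite /shift -map_comp -[RHS]map_id; apply/eq_in_map => row rT /=.
rewrite -map_comp -[RHS]map_id; apply/eq_in_map => -[|x] //= xr.
by case/negP: n0; apply/flattenP; exists row.
Qed.

Lemma insr_cat c p q s : size q = c -> c \notin shape p ->
  insr c (p ++ q :: s) = shift p ++ rcons (map S q) 1 :: shift s.
Proof.
move=> sq; elim: p => [|x p IH] /=; first by rewrite sq eqxx.
by rewrite inE eq_sym => /norP[/negPf -> /IH ->].
Qed.

Lemma incr_cat c p s : c \notin p -> incr c (p ++ c :: s) = Some (p ++ c.+1 :: s).
Proof.
elim: p => [|x p IH] /=; first by rewrite eqxx.
by rewrite inE eq_sym => /norP[/negPf -> /IH ->].
Qed.

Lemma good_del m T : good m.+1 T ->
  exists c T0, [/\ T = ins c T0, good m T0 & lop c (shape T0) = Some (shape T)].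
Proof.
move=> g; have n0 := good_pos g.
have : 1 \in flatten T by rewrite (perm_mem (good_perm g)) mem_iota.
move=> T1; have [p [s [q [q' eT]]]] : exists (p s : seq (seq nat)) (q q' : seq nat),
    T = p ++ (q ++ 1 :: q') :: s.
  case/flattenP: T1 => row /splitPr[p s] /splitPr[q q'].
  by exists p, s, q, q'.
rewrite {T T1}eT in g n0 *.
have entp j : ent (p ++ (q ++ 1 :: q') :: s) (size p) j = nth 0 (q ++ 1 :: q') j.
  by rewrite /ent nth_cat ltnn subnn.
(* Rows decrease and entries are positive, so 1 ends its row. *)
have q0 : q' = [::].
  have := good_row g (r := size p) (j := size q).
  have e1 : nth 0 (q ++ 1 :: q') (size q) = 1 by rewrite nth_cat ltnn subnn.
  have e2 : nth 0 (q ++ 1 :: q') (size q).+1 = nth 0 q' 0.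
    by rewrite nth_cat ltnNge leqnSn /= subSn // subnn.
  rewrite !entp e1 e2.
  case: q' n0 {g entp e1 e2} => // x q' n0 /= h; have x0 : 0 < x; last by have := h x0; lia.
  rewrite lt0n; apply: contraNneq n0 => <-.
  by rewrite flatten_cat /= !mem_cat !inE eqxx !orbT.
rewrite {q'}q0 cats1 in g n0 entp *.
have u : uniq (flatten (p ++ rcons q 1 :: s)).
  by rewrite (perm_uniq (good_perm g)) iota_uniq.
have pos2 x : x \in flatten p ++ q ++ flatten s -> 1 < x.
  move=> xin; have : x \in flatten (p ++ rcons q 1 :: s).
    by move: xin; rewrite flatten_cat /= !mem_cat mem_rcons inE => /or3P[] ->; rewrite ?orbT.
  rewrite (perm_mem (good_perm g)) mem_iota => /andP[x1 _].
  rewrite ltn_neqAle x1 andbT; apply: contraTneq u => x1'; rewrite -x1' in xin.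
  rewrite (perm_uniq (s2 := 1 :: flatten p ++ q ++ flatten s)) /= ?xin //.
  by apply/permP => f; rewrite flatten_cat -cats1 /= !count_cat /= ?count_cat /=; lia.
pose dn := map (map predn).
have posF X : (forall x, x \in flatten X -> 1 < x) -> 0 \notin flatten X /\ 0 \notin flatten (dn X).
  move=> h; split; first by apply/negP => /h.
  rewrite /dn -map_flatten; apply/negP => /mapP[x /h]; lia.
have nilF X : [::] \notin X -> [::] \notin dn X.
  by apply: contra => /mapP[[|//] h _].
have [sq0|qpos] := posnP (size q).
  have {sq0} q0 : q = [::] by case: (q) sq0.
  (* The first column increases downwards, so an entry 1 in it lies in the top row. *)
  subst q; have p0 : p = [::].
    case/lastP: p g entp {u} pos2 n0 => // p r g entp _ n0.
    have := good_col g (r := size p); rewrite -(size_rcons p r) entp /= => /(_ isT).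
    rewrite ltnS leqn0 => /eqP e; have := @ent_gt0 (rcons p r ++ [:: 1] :: s) (size p) 0 n0.
    rewrite e /= -cats1 -catA nth_cat ltnn subnn /= => /esym/negbT; rewrite -eqn0Ngt size_eq0.
    move=> /eqP; rewrite ?ltnn => r0; have := good_nil g; rewrite r0 mem_cat mem_rcons inE eqxx //.
  subst p; exists 0, (dn s); have [ns nds] := posF s pos2.
  have Ts : [:: 1] :: s = ins 0 (dn s) by rewrite /ins /= shift_pred.
  have l : lop 0 (shape (dn s)) = Some (shape ([:: 1] :: s)).
    by rewrite /lop /= -(shape_shift (dn s)) shift_pred.
  split => //; split.
  - by apply: nilF; have := good_nil g; rewrite inE negb_or => /andP[].
  - by rewrite -(perm_ins m l) -Ts; exact: good_perm g.
  - move=> r j; have := good_row g (r := r.+1) (j := j).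
    by rewrite Ts /ins /= !ent_cons !ent_shift // !upE; lia.
  - move=> r; have := good_col g (r := r.+1).
    by rewrite Ts /ins /= !ent_cons !ent_shift // !upE; lia.
  - move=> r r' j rr; have := good_tri g (r := r.+1) (s := r'.+1) (j := j) rr.
    by rewrite Ts /ins /= !ent_cons !ent_shift // !upE; lia.
set T0 := dn (p ++ q :: s).
have pq x : x \in flatten (p ++ q :: s) -> 1 < x.
  by rewrite flatten_cat /= => /pos2.
have [n0' nT0] := posF _ pq.
(* A row above of length [size q] would end in an entry larger than 1 with no box after it, against
   the triple condition for the entry 1. Hence [insr] puts 1 back into the same row. *)
have np : size q \notin shape p.
  apply/negP => /(nthP 0)[r]; rewrite size_map => rp; rewrite (nth_map [::]) // => er.
  have := good_tri g (j := (size q).-1) rp; rewrite prednK // !entp !nth_rcons ltnn eqxx.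
  have e j : ent (p ++ rcons q 1 :: s) r j = ent p r j by rewrite /ent nth_cat rp.
  rewrite !e [ent p r (size q)]nth_default ?er // => /(_ isT) h.
  suff : 1 < ent p r (size q).-1 by move=> /h.
  apply: pos2; rewrite mem_cat; apply/orP; left; apply/flattenP.
  exists (nth [::] p r); first exact: mem_nth.
  by apply: mem_nth; rewrite er; lia.
have shd X : shape (dn X) = shape X.
  by rewrite /shape -map_comp; apply: eq_map => x /=; rewrite size_map.
have T0E : T0 = dn p ++ map predn q :: dn s by rewrite /T0 /dn map_cat.
have TE : p ++ rcons q 1 :: s = insr (size q) T0.
  rewrite T0E (insr_cat (c := size q)) ?size_map ?shd //.
  move: n0'; rewrite flatten_cat mem_cat negb_or => /andP[/shift_pred -> h].
  by have [-> ->] := @shift_pred (q :: s) h.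
exists (size q), T0; rewrite /ins gtn_eqF //.
have l : lop (size q) (shape T0) = Some (shape (p ++ rcons q 1 :: s)).
  by rewrite /lop gtn_eqF // shd /shape !map_cat /= incr_cat // size_rcons.
have cT : size q \in shape T0 by rewrite shd /shape map_cat mem_cat /= inE eqxx orbT.
split => //; set k := index (size q) (shape T0).
have E r j : ent (p ++ rcons q 1 :: s) r j =
    if (r == k) && (j == size q) then 1 else ent T0 r j + (0 < ent T0 r j).
  by rewrite TE ent_insr // cT andbT upE.
have ekj j : (0 < ent T0 k j) = (j < size q) by apply: ent_index.
split.
- apply: nilF; have := good_nil g; rewrite !mem_cat !inE !negb_or => /and3P[-> _ ->].
  by rewrite andbT /= eq_sym -size_eq0 -lt0n.
- have := perm_ins m l; rewrite /ins gtn_eqF // -TE => <-; exact: good_perm g.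
- move=> r j; have := good_row g (r := r) (j := j); rewrite !E.
  have := ekj j; have := ekj j.+1; case: (eqVneq r k) => [->|_] /=; last by lia.
  by case: (eqVneq j.+1 (size q)) => jc1; case: (eqVneq j (size q)) => jc /=; lia.
- move=> r; have := good_col g (r := r); rewrite !E.
  by rewrite [0 == size q]eq_sym (gtn_eqF qpos) !andbF; lia.
move=> r r' j rr; have := good_tri g (j := j) rr; rewrite !E.
have := ekj j; have := ekj j.+1.
case: (eqVneq r' k) rr => [->|_]; case: (eqVneq r k) => [->|_] /= rr;
  by case: (eqVneq j.+1 (size q)) => jc1; case: (eqVneq j (size q)) => jc /=; lia.
Qed.

(** * The bijection between tableaux and column words *)

(** Inverse of [wordof]: every entry is inserted as 1 and raised by the later insertions. *)
Definition build (w : seq nat) := foldr ins [::] w.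

Lemma wordof_ins c T m a : good m T -> lop c (shape T) = Some a ->
  wordof m.+1 (ins c T) = c :: wordof m T.
Proof.
move=> g ca; rewrite /wordof iota1S map_cons (colof_ins1 (good_pos g) ca).
congr (_ :: _); rewrite -map_comp; apply/eq_in_map => v vm /=.
apply: colof_insS; first by move: vm; rewrite mem_iota => /andP[].
by rewrite (perm_mem (good_perm g)).
Qed.

Lemma good0 T : good 0 T <-> T = [::].
Proof.
split=> [g|->]; last by split => // r j; rewrite ?nth_nil // /ent !nth_nil.
have := good_perm g; have := good_nil g; case: T {g} => // -[//|x r] T _ /perm_size //.
Qed.

Lemma build_good w a : shp w = Some a ->
  [/\ good (size w) (build w), shape (build w) = a & wordof (size w) (build w) = w].
Proof.
elim: w a => [|c w IH] a /=; first by case=> <-; split => //; apply/good0.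
case: (shp w) IH => //= b /(_ b erefl)[g sb ww] ca; rewrite -sb in ca.
by split; [exact: good_ins g ca | exact: shape_ins | rewrite (wordof_ins g ca) ww].
Qed.

Lemma wordof_good m T : good m T ->
  shp (wordof m T) = Some (shape T) /\ build (wordof m T) = T.
Proof.
elim: m T => [|m IH] T; first by move/good0 => ->.
move/good_del => [c [T0 [-> g ca]]]; have [e1 e2] := IH T0 g.
by rewrite (wordof_ins g ca) /= e1 e2 /= ca.
Qed.

Lemma dcoefE N m a b : m <= N -> a \in comps m -> dcoef a b = wcount N m a b.
Proof.
move=> mN; rewrite mem_comps => /andP[pa /eqP sa]; rewrite /dcoef sa.
apply: (@count_bij _ _ _ _ _ _ (fun p => wordof m (reshape a p))
  (fun w => flatten (build w))); rewrite ?permutations_uniq ?uniq_words //.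
  move=> p; rewrite mem_permutations => pp.
  have sp : size p = m by rewrite (perm_size pp) size_iota.
  have fl : flatten (reshape a p) = p by rewrite reshapeKr // sa sp.
  have shr : shape (reshape a p) = a by rewrite reshapeKl // sa sp.
  have nT : [::] \notin reshape a p.
    by apply/negP => /(map_f size); rewrite -/(shape _) shr => /(allP pa).
  have pT : perm_eq (flatten (reshape a p)) (iota 1 m) by rewrite fl.
  case/andP => /(SRCT_good nT pT) g; rewrite /descomp /descents cdescE => db.
  have [e1 e2] := wordof_good g; rewrite shr in e1.
  rewrite e1 eqxx -/(wordof m _) db e2 fl; split=> //.
  by apply: sh_words e1; rewrite // /wordof size_map size_iota.
move=> w; rewrite mem_words => /andP[/eqP sw _] /andP[/eqP /build_good[g sb ww] db].
rewrite sw in g ww; have fl : reshape a (flatten (build w)) = build w by rewrite -sb flattenK.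
rewrite mem_permutations (good_perm g) fl ww; split => //.
rewrite /descomp /descents cdescE -/(wordof m _) ww db andbT.
by apply/(SRCT_good (good_nil g) (good_perm g)).
Qed.


(** * Invertibility of the transition matrices *)

(** The sum over all boxes of the diagram of their column numbers, counted from 1. *)
Definition stat (a : seq nat) : nat := sumn [seq 'C(x.+1, 2) | x <- a].

Lemma stat_cons x a : stat (x :: a) = 'C(x.+1, 2) + stat a.
Proof. by []. Qed.

Lemma bin2S x : 'C(x.+2, 2) = 'C(x.+1, 2) + x.+1.
Proof. by rewrite binS bin1. Qed.

Lemma stat_shp w a : shp w = Some a -> stat a = sumn (map S w).
Proof.
have lopE c b d : lop c b = Some d -> stat d = stat b + c.+1.
  rewrite /lop; case: eqP => [-> [<-]|_]; first by rewrite stat_cons addnC.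
  elim: b d => //= x b IH d; case: eqP => [-> [<-]|_].
    by rewrite !stat_cons bin2S; lia.
  by case: (incr c b) IH => //= b' /(_ b' erefl) e [<-]; rewrite !stat_cons e addnA.
elim: w a => [|c w IH] a /=; first by case=> <-.
by case: (shp w) IH => //= b /(_ b erefl) <- /lopE ->; rewrite addnC.
Qed.

(** A strictly decreasing run of length x has letters at least x-1, ..., 1, 0, so it contributes at
    least ['C(x.+1, 2)]. Equality forces these very letters in every run, and they build exactly the
    part x. *)
Lemma stat_cdesc w : [/\ head 0 (cdesc w) <= (head 0 w).+1,
  stat (cdesc w) <= sumn (map S w) &
  stat (cdesc w) = sumn (map S w) -> shp w = Some (cdesc w)].
Proof.
elim: w => [|c w [h le eq]]; first by split.
rewrite cdesc_cons; case: ifP => [_|/negbT].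
  rewrite stat_cons bin2S bin_small // map_cons [sumn _]/=; split=> [//||e].
    by lia.
  have c0 : c = 0 by lia.
  have {}eq : shp w = Some (cdesc w) by apply: eq; lia.
  by rewrite /= eq c0.
rewrite negb_or -ltnNge -cdesc_nil => /andP[nn hc].
case: (cdesc w) nn h le eq => // x r _ /= h; rewrite !stat_cons => le eq.
rewrite bin2S; split=> [||e]; [by lia | by lia | ].
have cx : c = x by lia.
have {}eq : shp w = Some (x :: r) by apply: eq; lia.
by rewrite eq /lop cx; case: eqP => [|_]; [lia | rewrite /= eqxx].
Qed.

(** The witness concatenates the runs x-1, ..., 1, 0 over the parts x of [a]. *)
Lemma cdesc_shp_onto a : is_comp a -> exists w,
  [/\ shp w = Some a, cdesc w = a & head 0 w = (head 0 a).-1].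
Proof.
have [n] := ubnP (sumn a); elim: n a => // n IH [|[|[|x]] a] //= lt pa.
- by exists [::].
- have la : sumn a < n by lia.
  have [w [e1 e2 _]] := IH a la pa.
  by exists (0 :: w); rewrite cdesc_cons e2 orbT /= e1.
have la : sumn (x.+1 :: a) < n by rewrite /=; lia.
have [w [e1 e2 e3]] := IH (x.+1 :: a) la pa.
exists (x.+1 :: w); rewrite cdesc_cons -cdesc_nil e2 e3 /= ltnn e1; split=> //.
by rewrite /lop /= eqxx.
Qed.

(** Triangular for [stat]: a word has a shape of larger [stat] than its descent composition unless
    the two agree, and the word of decreasing runs makes the diagonal nonzero. *)
Lemma Dmx_unit m : Dmx m \in unitmx.
Proof.
apply: (triangular_unitmx (f := fun i => stat (cmp i))) => [i|i j ij].
  rewrite mxE pnatr_eq0 (dcoefE _ (leqnn m) (cmpP i)) -lt0n -has_count.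
  have := cmpP i; rewrite mem_comps => /andP[/cdesc_shp_onto[w [e1 e2 _]] /eqP s].
  apply/hasP; exists w; last by rewrite e1 e2 !eqxx.
  apply: sh_words e1 => //; have := cdesc_comps w.
  by rewrite e2 mem_comps => /andP[_ /eqP <-].
rewrite mxE pnatr_eq0 (dcoefE _ (leqnn m) (cmpP i)) -lt0n -has_count.
case/hasP => w _ /andP[/eqP e1 /eqP e2]; have [_ le eq] := stat_cdesc w.
rewrite (stat_shp e1) -e2 ltn_neqAle le andbT; apply: contraNneq ij => /eq.
by rewrite e1 e2 => -[/cmp_inj ->].
Qed.

(** * Coarsenings and the ribbon matrix *)

Lemma coarsensP a b : reflect
  (exists ll : seq (seq nat), [/\ [::] \notin ll, flatten ll = b & map sumn ll = a]) (coarsens a b).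
Proof.
apply: (iffP hasP) => [[l]|[ll [nl fl sl]]].
  rewrite mem_comps => /andP[pl /eqP sl] /eqP e; exists (reshape l b); split => //.
    apply/negP => /(map_f size); rewrite -/(shape _) reshapeKl ?sl //.
    by move/(allP pl).
  by rewrite reshapeKr ?sl.
exists (shape ll); last by rewrite -fl flattenK sl.
rewrite mem_comps -fl size_flatten eqxx andbT; apply/allP => x /mapP[r rl ->].
by rewrite lt0n size_eq0; apply: contraNneq nl => <-.
Qed.

Lemma coarsens_size a b : coarsens a b -> a = b \/ size a < size b.
Proof.
case/coarsensP => ll [+ <- <-]; elim: ll => [|r ll IH] /=; first by left.
rewrite inE negb_or size_cat => /andP[rn /IH].
case: r rn => // x [|y r] _ [e|lt] /=; rewrite ?addn0.
- by left; rewrite e.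
- by right.
- by right; rewrite e; lia.
by right; lia.
Qed.

Lemma coarsens_refl b : coarsens b b.
Proof.
apply/coarsensP; exists [seq [:: x] | x <- b]; split.
- by apply/negP => /mapP[].
- by elim: b => //= x b ->.
by elim: b => //= x b ->; rewrite addn0.
Qed.

(** Triangular for the number of parts, as a proper coarsening is shorter; the transpose has the
    orientation required by [triangular_unitmx]. *)
Lemma Hmx_unit m : Hmx m \in unitmx.
Proof.
rewrite -unitmx_tr; apply: (triangular_unitmx (f := fun i => size (cmp i))) => [i|i j ij].
  by rewrite !mxE /rcoef coarsens_refl subnn oner_eq0.
rewrite !mxE /rcoef; case: ifP; last by rewrite eqxx.
by case/coarsens_size => // /cmp_inj e; rewrite e eqxx in ij.
Qed.

Lemma Smx_unit m : Smx m \in unitmx.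
Proof. by rewrite /Smx unitmx_mul Hmx_unit unitmx_inv Dmx_unit. Qed.

Lemma coarsens_rcons t z b y : coarsens (rcons t z) (rcons b y) <->
  exists b1 g, [/\ b = b1 ++ g, sumn g + y = z & coarsens t b1].
Proof.
split=> [/coarsensP[ll []]|[b1 [g [-> <- /coarsensP[ll [nl <- <-]]]]]].
  case/lastP: ll => [_ _|ll g]; first by case: t.
  rewrite mem_rcons inE negb_or -cats1 flatten_cat /= cats0 map_cat cats1.
  case/andP; case/lastP: g => // g x _ nl; rewrite -rcons_cat => /rcons_inj[fl ->].
  move=> /rcons_inj[e1 e2]; exists (flatten ll), g; split=> //.
    by rewrite -e2 sumn_rcons.
  by apply/coarsensP; exists ll.
apply/coarsensP; exists (rcons ll (rcons g y)); split.
- by rewrite mem_rcons inE negb_or nl andbT; case: g.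
- by rewrite -cats1 flatten_cat /= cats0 rcons_cat.
by rewrite map_rcons sumn_rcons.
Qed.

Local Open Scope ring_scope.

Lemma inclast_rcons b y : inclast (rcons b y) = rcons b y.+1.
Proof. by case: b => //= x b; rewrite belast_rcons last_rcons. Qed.

(** * The right Pieri rule *)

(* The coefficient of h_(rcons t z) in r_b h_1 = r_(b.1) + r_(b(.)1). *)
Lemma rcoef_mul_h1 m b t z : b \in comps m -> rcons t z \in comps m.+1 ->
  rcoef (rcons t z) (rcons b 1) +
    (if b == [::] then 0 else rcoef (rcons t z) (inclast b)) =
  if z == 1%N then rcoef t b else 0.
Proof.
rewrite !mem_comps => /andP[pb /eqP sb] /andP[pt /eqP st].
have iffb (P Q : bool) : P <-> Q -> P = Q by move=> [h1 h2]; apply/idP/idP.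
have z0 : (0 < z)%N by move: pt; rewrite /is_comp all_rcons => /andP[].
case: (lastP b) pb sb => [_ /= m0|b' y pb sb].
  move: st; rewrite -m0 /= sumn_rcons addr0 => st.
  have {st} [-> t0] : z = 1%N /\ sumn t = 0%N by lia.
  have -> : t = [::].
    by case: t pt t0 => // x t /=; rewrite /is_comp /= => /andP[x0 _]; lia.
  by [].
have -> : (rcons b' y == [::]) = false by case: (b').
rewrite inclast_rcons; have [y0 pb'] : (0 < y)%N /\ is_comp b'.
  by move: pb; rewrite /is_comp all_rcons => /andP[].
case: eqP => [->|z1].
  (* The last part of b(.)1 is at least 2 and does not fit into a block of sum 1. *)
  have -> : rcoef (rcons t 1) (rcons b' y.+1) = 0.
    rewrite /rcoef; case: ifP => // /coarsens_rcons[b1 [g [_ + _]]]; lia.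
  rewrite addr0 /rcoef !size_rcons subSS.
  rewrite (iffb (coarsens (rcons t 1) _) (coarsens t (rcons b' y))) //.
  split=> [/coarsens_rcons[b1 [g [e sg h]]]|h]; last first.
    by apply/coarsens_rcons; exists (rcons b' y), [::]; rewrite cats0.
  suff g0 : g = [::] by rewrite e g0 cats0.
  move: pb; rewrite e /is_comp all_cat => /andP[_].
  by case: g sg {e} => //= x g sg /andP[x0 _]; lia.
(* For [z > 1] the last block contains both the final 1 and the part [y] before it, so merging these
   two allows the same coarsenings. The lengths differ by one and the signs cancel. *)
have e : coarsens (rcons t z) (rcons (rcons b' y) 1) = coarsens (rcons t z) (rcons b' y.+1).
  apply: iffb; split=> /coarsens_rcons[b1 [g [e sg h]]]; apply/coarsens_rcons.
    case/lastP: g e sg => [_ /= |g x]; first by move=> z1'; case: z1; rewrite -z1'.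
    rewrite -rcons_cat sumn_rcons => /rcons_inj[-> ->] sg.
    by exists b1, g; split => //; lia.
  exists b1, (rcons g y); rewrite e rcons_cat sumn_rcons; split => //; lia.
rewrite /rcoef e; case: ifP => [h|_]; last by rewrite addr0.
have le : (size (rcons t z) <= size (rcons b' y.+1))%N.
  by case: (coarsens_size h) => [->|/ltnW].
have -> : size (rcons (rcons b' y) 1) = (size (rcons b' y.+1)).+1 by rewrite !size_rcons.
by rewrite subSn // exprS mulN1r addNr.
Qed.

Lemma sum_delta m c (F : seq nat -> rat) :
  \sum_(k < nc m) (cmp k == c)%:R * F (cmp k) = if c \in comps m then F c else 0.
Proof.
rewrite (sum_cmp m (fun d => (d == c)%:R * F d)); case: ifP => [cm|/negbT ncm].
  rewrite -(sum_pick F cm); apply: eq_bigr => d _.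
  by case: eqP => _; rewrite ?mul1r ?mul0r.
rewrite big_seq big1 // => d dm; have -> : d == c = false; last by rewrite mul0r.
by apply: contraNF ncm => /eqP <-.
Qed.

(** [Pmx], [Qmx] and [Umx] represent right multiplication by h_1 in the bases h, r and s; for [Umx]
    this is the Pieri rule [right_pieri]. *)
Definition Pmx m : 'M[rat]_(nc m.+1, nc m) :=
  \matrix_(i, j) (cmp i == rcons (cmp j) 1)%:R.
Definition Qmx m : 'M[rat]_(nc m.+1, nc m) :=
  \matrix_(i, j) ((cmp i == rcons (cmp j) 1)%:R + (cmp i == inclast (cmp j))%:R).
Definition Umx m : 'M[rat]_(nc m.+1, nc m) :=
  \matrix_(i, j) (covb (cmp j) (cmp i))%:R.

Lemma rcons_comps m b : b \in comps m -> rcons b 1 \in comps m.+1.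
Proof. by rewrite !mem_comps /is_comp all_rcons sumn_rcons addn1 eqSS. Qed.

Lemma inclast_comps m b : b \in comps m -> (inclast b \in comps m.+1) = (b != [::]).
Proof.
rewrite !mem_comps; case/lastP: b => // b y; rewrite inclast_rcons /is_comp !all_rcons.
rewrite !sumn_rcons addnS eqSS => /andP[/andP[_ ->] ->]; by case: b.
Qed.

Lemma sum_Qmx m (F : seq nat -> rat) (j : 'I_(nc m)) :
  \sum_(k < nc m.+1) F (cmp k) * Qmx m k j =
  F (rcons (cmp j) 1) + (if cmp j == [::] then 0 else F (inclast (cmp j))).
Proof.
under eq_bigr do rewrite mxE mulrC mulrDl.
rewrite big_split /= !sum_delta rcons_comps ?cmpP // inclast_comps ?cmpP //.
by case: eqP.
Qed.

Lemma sum_Pmx m (F : seq nat -> rat) (i : 'I_(nc m.+1)) t z : cmp i = rcons t z ->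
  \sum_(k < nc m) Pmx m i k * F (cmp k) = if z == 1%N then F t else 0.
Proof.
move=> e; have tm : z = 1%N -> t \in comps m.
  move=> z1; have := cmpP i; rewrite e z1 !mem_comps /is_comp all_rcons sumn_rcons.
  by rewrite addn1 eqSS.
under eq_bigr do rewrite mxE e eqseq_rcons.
case: eqP => [z1|_]; last by rewrite big1 // => k _; rewrite andbF mul0r.
under eq_bigr do rewrite andbT eq_sym.
by rewrite sum_delta tm.
Qed.

Lemma PH m : Pmx m *m Hmx m = Hmx m.+1 *m Qmx m.
Proof.
apply/matrixP => i j; rewrite !mxE.
under [LHS]eq_bigr do rewrite [Hmx _ _ _]mxE.
under [RHS]eq_bigr do rewrite [Hmx _ _ _]mxE.
rewrite (sum_Qmx (rcoef (cmp i))); have := cmpP i.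
case/lastP E: (cmp i) => [|t z] im; first by move: im; rewrite mem_comps.
by rewrite (rcoef_mul_h1 (cmpP j) im) (sum_Pmx (rcoef^~ (cmp j)) E).
Qed.

Lemma DQ m : Dmx m.+1 *m Qmx m = Umx m *m Dmx m.
Proof.
apply/matrixP => i j; rewrite !mxE.
under [LHS]eq_bigr do rewrite [Dmx _ _ _]mxE.
rewrite (sum_Qmx (fun b => (dcoef (cmp i) b)%:R)).
(* For the empty composition [inclast] returns its default [[::]], which is the descent composition
   of no nonempty word, so the extra term is 0. *)
have -> : (if cmp j == [::] then 0 else (dcoef (cmp i) (inclast (cmp j)))%:R) =
    (wcount m.+1 m.+1 (cmp i) (inclast (cmp j)))%:R :> rat.
  rewrite -(dcoefE _ (leqnn _) (cmpP i)); case: eqP => // e.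
  have m0 : m = 0%N by have := cmpP j; rewrite e mem_comps => /eqP.
  apply/esym/eqP; rewrite pnatr_eq0 e (dcoefE _ (leqnn _) (cmpP i)) -leqn0 leqNgt -has_count.
  apply/hasPn => w; rewrite mem_words => /andP[/eqP sw _]; rewrite negb_and cdesc_nil.
  by rewrite -size_eq0 sw orbT.
rewrite (dcoefE _ (leqnn _) (cmpP i)) -natrD wcount_slide ?cmpP // natr_sum.
rewrite -(sum_cmp m (fun a => (covb a (cmp i) * wcount m.+1 m a (cmp j))%:R)).
by apply: eq_bigr => k _; rewrite !mxE natrM (dcoefE _ (leqnSn m) (cmpP k)).
Qed.

(** By [DQ], [Qmx m *m invmx (Dmx m)] equals [invmx (Dmx m.+1) *m Umx m]; [PH] brings the left side
    to [Hmx m.+1] times the former. *)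
Lemma right_pieri m : Pmx m *m Smx m = Smx m.+1 *m Umx m.
Proof.
rewrite /Smx mulmxA PH -[LHS]mulmxA -[RHS]mulmxA; congr (_ *m _).
rewrite -[Umx m](mulmxK (Dmx_unit m)) -DQ.
by rewrite !mulmxA mulVmx ?Dmx_unit // mul1mx.
Qed.

(** * Chains as coefficients of products with powers of h_1 *)

Lemma scoefE m (i j : 'I_(nc m)) : scoef m (cmp i) (cmp j) = Smx m i j.
Proof.
rewrite /scoef (bigD1 i) //= (bigD1 j) //= !eqxx /= !big1 ?addr0 // => k ki.
  by rewrite big1 // => l _; rewrite (inj_eq (@cmp_inj m)) (negPf ki).
by rewrite (inj_eq (@cmp_inj m)) (negPf ki).
Qed.

Lemma scoef_pieri m t z a : rcons t z \in comps m.+1 -> a \in comps m ->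
  \sum_(b <- comps m.+1) scoef m.+1 (rcons t z) b * (covb a b)%:R =
  if z == 1%N then scoef m t a else 0.
Proof.
move=> /cmp_onto[i e] /cmp_onto[j <-]; have /matrixP/(_ i j) := right_pieri m.
rewrite !mxE -(sum_cmp _ (fun b => scoef m.+1 (rcons t z) b * (covb (cmp j) b)%:R)) -e.
under [RHS]eq_bigr do rewrite -scoefE [Umx _ _ _]mxE.
move=> <-; under eq_bigr do rewrite -scoefE.
exact: (sum_Pmx (scoef m ^~ (cmp j))).
Qed.

(* Both sides are the coefficient of h_t in the product of s_a and h_1^k. *)
Lemma scoef_chains m k a t : a \in comps m -> t \in comps (m + k) ->
  \sum_(b <- comps (m + k)) scoef (m + k) t b * (nchains k a b)%:R =
  \sum_(t1 <- comps m) (if t1 ++ nseq k 1%N == t then scoef m t1 a else 0).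
Proof.
move=> am; elim: k t => [|k IH] t.
  rewrite addn0 => tm; under [RHS]eq_bigr do rewrite cats0.
  rewrite (sum_pick _ tm) -(sum_pick (scoef m t) am); apply: eq_bigr => b _ /=.
  by rewrite eq_sym; case: eqP; rewrite ?mulr1 ?mulr0.
rewrite addnS; case/lastP: t => [|t z tm]; first by rewrite mem_comps.
under [LHS]eq_big_seq => b.
  rewrite mem_comps => /andP[_ /eqP sb]; rewrite [nchains _ _ _]/= sb /= natr_sum mulr_sumr.
  over.
(* The last step of a chain is a cover of [d] by [b]. Summing over [b] with the Pieri rule strips a
   final part 1 from the index and leaves degree [m + k]. *)
rewrite exchange_big /=.
under eq_big_seq => d dm.
  under eq_bigr do rewrite natrM mulrCA.
  rewrite -mulr_sumr (scoef_pieri tm dm).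
  over.
have e t1 : (t1 ++ nseq k.+1 1%N == rcons t z) = (t1 ++ nseq k 1%N == t) && (z == 1%N).
  by rewrite -[k.+1]addn1 nseqD catA cats1 eqseq_rcons [1%N == z]eq_sym.
under [RHS]eq_bigr do rewrite e.
case: eqP tm => [-> tm|_ _]; last first.
  by rewrite !big1 // => d _; rewrite ?andbF ?mulr0.
under [RHS]eq_bigr do rewrite andbT.
rewrite -IH; first by apply: eq_bigr => d _; rewrite mulrC.
by move: tm; rewrite !mem_comps /is_comp all_rcons sumn_rcons addn1 eqSS.
Qed.

Lemma scoef0 : scoef 0 [::] [::] = 1.
Proof.
have [i e] : exists i : 'I_(nc 0), cmp i = [::] by apply: cmp_onto.
rewrite -e scoefE /Smx.
have one (j k : 'I_(nc 0)) : j = k by apply: val_inj; case: j k => [[|j] hj] [[|k] hk].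
have -> : Dmx 0 = 1%:M.
  apply/matrixP => j k; rewrite !mxE (one j i) (one k i) eqxx e.
  by rewrite (dcoefE (N := 0) (m := 0)).
by rewrite invmx1 mulmx1 mxE e /rcoef coarsens_refl.
Qed.

Theorem theorem9p4 (alpha beta : seq nat) :
  is_comp alpha -> is_comp beta ->
  (fchains alpha beta)%:R =
    \sum_(gamma <- comps (sumn beta - sumn alpha))
       Ccoef alpha gamma beta * (fchains [::] gamma)%:R :> rat.
Proof.
move=> pa pb; rewrite /fchains; have [le|lt] := leqP (sumn alpha) (sumn beta); last first.
  (* Truncated subtraction leaves only the empty [gamma]; its coefficient is 0 for degree reasons,
     and [alpha] differs from [beta]. *)
  have -> : (sumn beta - sumn alpha = 0)%N by lia.
  rewrite [comps _]/(comps 0) big_seq1 /Ccoef [sumn [::]]/= addn0 ltn_eqF // mul0r /=.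
  by rewrite (_ : alpha == beta = false) //; apply: contraTF lt => /eqP ->; rewrite ltnn.
set m := sumn alpha in le *; set k := (sumn beta - m)%N.
have am : alpha \in comps m by rewrite mem_comps pa eqxx.
have sb : sumn beta = (m + k)%N by rewrite subnKC.
have /cmp_onto[ib eb] : beta \in comps (m + k) by rewrite mem_comps pb sb eqxx.
have C g : g \in comps k -> Ccoef alpha g beta =
    \sum_(j < nc (m + k)) invmx (Smx (m + k)) ib j * prodcoef alpha g (cmp j).
  rewrite mem_comps => /andP[_ /eqP sg]; rewrite /Ccoef sg sb -/m eqxx.
  rewrite (bigD1 ib) //= [X in _ + X]big1 ?addr0; last first.
    move=> i ne; rewrite big1 // => j _.
    by rewrite -eb (inj_eq (@cmp_inj _)) (negPf ne).
  by apply: eq_bigr => j _; rewrite eb eqxx.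
under [RHS]eq_big_seq => g gk.
  rewrite (C g gk) mulr_suml.
  have -> : sumn g = k by move: gk; rewrite mem_comps => /andP[_ /eqP].
  rewrite subn0; over.
rewrite exchange_big /=.
(* Both sides are h-coefficients of s_alpha h_1^k: on the left h_1^k is expanded in the s_g, on the
   right the product is expanded by chains from [alpha]. *)
have prod (j : 'I_(nc (m + k))) :
    \sum_(g <- comps k) prodcoef alpha g (cmp j) * (nchains k [::] g)%:R =
    \sum_(i < nc (m + k)) Smx (m + k) j i * (nchains k alpha (cmp i))%:R.
  under [RHS]eq_bigr do rewrite -scoefE.
  rewrite (sum_cmp _ (fun b => scoef (m + k) (cmp j) b * (nchains k alpha b)%:R)).
  rewrite (scoef_chains am (cmpP j)).
  under eq_big_seq => g.
    rewrite mem_comps => /andP[_ /eqP sg]; rewrite /prodcoef sg -/m mulr_suml.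
    under eq_bigr do rewrite mulr_suml.
    over.
  rewrite exchange_big /=; apply: eq_bigr => t1 _; rewrite exchange_big /=.
  have km : nseq k 1%N \in comps k.
    rewrite mem_comps sumn_nseq mul1n eqxx andbT; apply/allP => x.
    by rewrite mem_nseq => /andP[_ /eqP ->].
  rewrite -(sum_pick (fun t2 => if t1 ++ t2 == cmp j then scoef m t1 alpha else 0) km).
  apply: eq_big_seq => t2 tk.
  (* In degree 0 the chain formula expands h_1^k itself, so only [t2 = nseq k 1] contributes. *)
  have /= := @scoef_chains 0 k [::] t2 isT tk; rewrite big_seq1 scoef0 /= => e.
  rewrite [X in if X then _ else _]eq_sym; case: (t1 ++ t2 == cmp j); last first.
    by rewrite big1; [case: ifP | move=> g _; rewrite mul0r].
  under eq_bigr do rewrite -mulrA; rewrite -mulr_sumr e.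
  by case: ifP; rewrite ?mulr1 ?mulr0.
under eq_bigr => j _.
  under eq_bigr do rewrite -mulrA.
  rewrite -mulr_sumr prod; over.
(* [Smx] times the column [v] of chain numbers gives the h-coordinates of s_alpha h_1^k; applying
   the inverse and reading the entry at [beta] returns the number of chains. *)
pose v : 'cV[rat]_(nc (m + k)) := \col_i (nchains k alpha (cmp i))%:R.
transitivity ((invmx (Smx (m + k)) *m (Smx (m + k) *m v)) ib 0).
  by rewrite mulmxA mulVmx ?Smx_unit // mul1mx mxE eb.
rewrite mxE; apply: eq_bigr => j _; congr (_ * _); rewrite mxE.
by apply: eq_bigr => i _; rewrite [v _ _]mxE.
Qed.
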